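(* Let $X$, $U$ be Banach spaces and let $\mathcal{U}:=L^p(\mathbb{R}^+_0,U)$ for some $p\in[1,\infty)\cup\{\infty\}$, with norm $\|\cdot\|_{\mathcal{U}}=\|\cdot\|_p$. Let $A$ be the generator of a (strongly continuous) semigroup on $X$ and let $B\in L(U,X_{-1})$ be a $\mathcal{U}$-admissible control operator for $A$, that is, $$\Phi_t(u):=\int_0^t e^{A_{-1}(t-s)}Bu(s)\,ds\in X\qquad(t\in\mathbb{R}^+_0\text{ and }u\in\mathcal{U}).$$ In case $p=\infty$, additionally assume that $t\mapsto\Phi_t(u)\in X$ is continuous for every $u\in\mathcal{U}$. Then $\mathfrak{S}:=(X,\mathcal{U},\varphi)$ with $$\varphi(t,x_0,u):=e^{At}x_0+\int_0^t e^{A_{-1}(t-s)}Bu(s)\,ds\qquad((t,x_0,u)\in\mathbb{R}^+_0\times X\times\mathcal{U})$$ is a dynamical system with inputs, and $\mathfrak{S}$ is weakly input-to-state stable if and only if it is strongly input-to-state stable.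
   Context: Notation: $\mathbb{R}^+_0=[0,\infty)$; $\|\cdot\|_p$ is the standard norm on $L^p(\mathbb{R}^+_0,U)$ (functions identified when equal almost everywhere). $(e^{At})_{t\ge0}$ denotes the semigroup generated by $A$. The extrapolation space $X_{-1}$ of $A$ is the completion of $X$ with respect to the norm $\|(\lambda-A)^{-1}\cdot\|$ for some (any) $\lambda$ in the resolvent set of $A$; the semigroup $e^{A\cdot}$ extends uniquely to a strongly continuous semigroup on $X_{-1}$, whose generator is denoted $A_{-1}$. $L(U,X_{-1})$ denotes the bounded linear operators from $U$ to $X_{-1}$; the integral is taken in $X_{-1}$. $\mathcal{K}$ is the set of continuous strictly increasing functions $\gamma:\mathbb{R}^+_0\to\mathbb{R}^+_0$ with $\gamma(0)=0$. For functions $u_1,u_2$ on $\mathbb{R}^+_0$ and $\tau\in\mathbb{R}^+_0$, the concatenation $u_1\,\&_\tau u_2$ is defined by $(u_1\,\&_\tau u_2)(t)=u_1(t)$ for $t\in[0,\tau)$ and $=u_2(t-\tau)$ for $t\ge\tau$. Dynamical system with inputs: a triple $\mathfrak{S}=(X,\mathcal{U},\varphi)$, where $X$ is a normed linear space with norm $\|\cdot\|$; $\mathcal{U}$ is a non-empty set of functions $u:\mathbb{R}^+_0\to U$ endowed with a norm $\|\cdot\|_{\mathcal{U}}$ (meaning the restriction to $\mathcal{U}$ of a norm on some linear space containing $\mathcal{U}$); and $\varphi:\mathbb{R}^+_0\times X\times\mathcal{U}\to X$ is a map, such that: (1) $u(\cdot+\tau)\in\mathcal{U}$ and $\|u(\cdot+\tau)\|_{\mathcal{U}}\le\|u\|_{\mathcal{U}}$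 for all $u\in\mathcal{U}$, $\tau\ge0$; (2) $u_1\,\&_\tau u_2\in\mathcal{U}$ for all $u_1,u_2\in\mathcal{U}$, $\tau\ge0$; (3) $\varphi(0,x_0,u)=x_0$ and $\varphi(t+s,x_0,u)=\varphi(t,\varphi(s,x_0,u),u(\cdot+s))$ for all $(x_0,u)\in X\times\mathcal{U}$, $s,t\ge0$; (4) $\varphi(\cdot,x_0,u):\mathbb{R}^+_0\to X$ is continuous for all $(x_0,u)$; (5) if $u_1|_{[0,\tau]}=u_2|_{[0,\tau]}$, then $\varphi(\cdot,x_0,u_1)|_{[0,\tau]}=\varphi(\cdot,x_0,u_2)|_{[0,\tau]}$, for all $x_0\in X$, $u_1,u_2\in\mathcal{U}$, $\tau\ge0$. Stability notions for $\mathfrak{S}$: - Uniformly globally stable: there exist $\underline\sigma,\underline\gamma\in\mathcal{K}$ such that $\|\varphi(t,x_0,u)\|\le\underline\sigma(\|x_0\|)+\underline\gamma(\|u\|_{\mathcal{U}})$ for all $(x_0,u)\in X\times\mathcal{U}$, $t\ge0$. - Of weak asymptotic gain: there is $\overline\gamma\in\mathcal{K}\cup\{0\}$ such that for every $\varepsilon>0$ and $(x_0,u)\in X\times\mathcal{U}$ there is $\overline\tau(\varepsilon,x_0,u)\in\mathbb{R}^+_0$ with $\|\varphi(t,x_0,u)\|\le\varepsilon+\overline\gamma(\|u\|_{\mathcal{U}})$ for all $t\ge\overline\tau(\varepsilon,x_0,u)$. - Of strong asymptotic gain: there is $\overline\gamma\in\mathcal{K}\cup\{0\}$ such that for every $\varepsilon>0$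 and $x_0\in X$ there is $\overline\tau(\varepsilon,x_0)\in\mathbb{R}^+_0$ with $\|\varphi(t,x_0,u)\|\le\varepsilon+\overline\gamma(\|u\|_{\mathcal{U}})$ for all $t\ge\overline\tau(\varepsilon,x_0)$ and all $u\in\mathcal{U}$. - Weakly (resp. strongly) input-to-state stable: uniformly globally stable and of weak (resp. strong) asymptotic gain. *)

(* Defs.v *)
From HB Require Import structures.
From mathcomp Require Import all_boot all_order all_algebra.
From mathcomp Require Import all_classical all_reals all_analysis.

Set Implicit Arguments.
Unset Strict Implicit.
Unset Printing Implicit Defensive.

Import Order.TTheory GRing.Theory Num.Theory.
Import numFieldNormedType.Exports.

Local Open Scope classical_set_scope.
Local Open Scope ring_scope.

(* Scalars are real: a complex Banach space is a real one by restriction of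
   scalars.  Functions on [0, +oo[ are represented by functions on R whose
   values at negative arguments are irrelevant. *)

Definition nonnegatives {R : realType} : set R := [set t | 0 <= t].

(** * Dynamical systems with inputs *)

Section comparison_functions.
Context {R : realType}.

Definition classK (g : R -> R) : Prop :=
  [/\ {within nonnegatives, continuous g},
      forall r s, 0 <= r -> r < s -> g r < g s & g 0 = 0].

Definition classK0 (g : R -> R) : Prop :=
  classK g \/ (forall r, 0 <= r -> g r = 0).

End comparison_functions.

Section input_functions.
Context {R : realType} {U : Type}.

Definition shift_input (tau : R) (u : R -> U) : R -> U := fun t => u (t + tau).

Definition concat_input (u1 : R -> U) (tau : R) (u2 : R -> U) : R -> U :=
  fun t => if t < tau then u1 t else u2 (t - tau).

(* Equality of the restrictions of u1 and u2 to D, up to the exceptional sets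
   allowed by the filter F. *)
Definition eq_upto (F : set_system R) (D : set R) (u1 u2 : R -> U) : Prop :=
  \forall t \near F, D t -> u1 t = u2 t.

End input_functions.

(* The triple (X, inputs, flow), with the norm on the inputs.  Elements of
   [inputs] are identified when they coincide on a set of the filter [ident]:
   - for plain functions on [0, +oo[, [ident] is [globally nonnegatives], and
     [eq_upto ident D] is pointwise equality on D `&` [0, +oo[;
   - for L^p, [ident] is the filter of sets of full measure in [0, +oo[. *)
Record input_system (R : realType) (X U : normedModType R) := InputSystem {
  ident : set_system R ;
  inputs : set (R -> U) ;
  input_norm : (R -> U) -> R ;
  flow : R -> X -> (R -> U) -> X }.

Section input_system_theory.
Context {R : realType} {X U : normedModType R}.
Implicit Types (F : set_system R) (W : set (R -> U)) (N : (R -> U) -> R).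

Definition is_linear_function_space W : Prop :=
  W (fun=> 0) /\
  (forall (a : R) u v, W u -> W v -> W (fun t => a *: u t + v t)).

(* N is a norm on the linear space W modulo [eq_upto F nonnegatives]. *)
Definition is_norm_upto F W N : Prop :=
  [/\ forall u v, W u -> W v -> N (fun t => u t + v t) <= N u + N v,
      forall (a : R) u, W u -> N (fun t => a *: u t) = `|a| * N u &
      forall u, W u -> N u = 0 <-> eq_upto F nonnegatives u (fun=> 0)].

Variable S : input_system X U.

Local Notation "u =~ v" := (eq_upto (ident S) nonnegatives u v) (at level 70).

Record dynamical_system_with_inputs : Prop := {
  ident_filter : Filter (ident S) ;
  inputs_neq0 : inputs S !=set0 ;
  inputs_saturated : forall u v, inputs S u -> u =~ v -> inputs S v ;
  inputs_normed : exists (W : set (R -> U)) (N : (R -> U) -> R),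
    [/\ is_linear_function_space W, is_norm_upto (ident S) W N,
        inputs S `<=` W & forall u, inputs S u -> input_norm S u = N u] ;
  inputs_shift : forall u tau, inputs S u -> 0 <= tau ->
    inputs S (shift_input tau u) /\
    input_norm S (shift_input tau u) <= input_norm S u ;
  inputs_concat : forall u1 u2 tau, inputs S u1 -> inputs S u2 -> 0 <= tau ->
    inputs S (concat_input u1 tau u2) ;
  flow0 : forall x0 u, inputs S u -> flow S 0 x0 u = x0 ;
  flow_cocycle : forall x0 u s t, inputs S u -> 0 <= s -> 0 <= t ->
    flow S (t + s) x0 u = flow S t (flow S s x0 u) (shift_input s u) ;
  flow_continuous : forall x0 u, inputs S u ->
    {within nonnegatives, continuous (fun t => flow S t x0 u)} ;
  (* also makes [flow] well defined modulo [ident S] *)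
  flow_causal : forall x0 u1 u2 tau, inputs S u1 -> inputs S u2 -> 0 <= tau ->
    eq_upto (ident S) `[0, tau] u1 u2 ->
    forall t, 0 <= t <= tau -> flow S t x0 u1 = flow S t x0 u2 }.

Definition uniformly_globally_stable : Prop :=
  exists sigma gamma : R -> R, [/\ classK sigma, classK gamma &
    forall x0 u t, inputs S u -> 0 <= t ->
      `|flow S t x0 u| <= sigma `|x0| + gamma (input_norm S u)].

Definition weak_asymptotic_gain : Prop :=
  exists2 gamma : R -> R, classK0 gamma &
    forall eps x0 u, 0 < eps -> inputs S u ->
      exists2 tau, 0 <= tau & forall t, tau <= t ->
        `|flow S t x0 u| <= eps + gamma (input_norm S u).

Definition strong_asymptotic_gain : Prop :=
  exists2 gamma : R -> R, classK0 gamma &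
    forall eps x0, 0 < eps ->
      exists2 tau, 0 <= tau & forall t u, tau <= t -> inputs S u ->
        `|flow S t x0 u| <= eps + gamma (input_norm S u).

Definition weakly_ISS : Prop :=
  uniformly_globally_stable /\ weak_asymptotic_gain.

Definition strongly_ISS : Prop :=
  uniformly_globally_stable /\ strong_asymptotic_gain.

End input_system_theory.

(** * Bochner integral *)

Section bochner.
Context {d : measure_display} {T : measurableType d} {R : realType}.
Context {V : normedModType R}.
Variable mu : {measure set T -> \bar R}.
Implicit Types (s : {fimfun T >-> V}) (D : set T) (f : T -> V).

Definition measurable_simple s : Prop := forall v, measurable (s @^-1` [set v]).

Definition strongly_measurable f : Prop :=
  exists2 s : nat -> {fimfun T >-> V}, (forall n, measurable_simple (s n)) &
    \forall t \ae mu, s n t @[n --> \oo] --> f t.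

Definition integrable_simple D s : Prop :=
  measurable_simple s /\
  (forall v, v != 0 -> (mu (D `&` s @^-1` [set v]) < +oo)%E).

Definition simple_integral D s : V :=
  \sum_(v \in range s) fine (mu (D `&` s @^-1` [set v])) *: v.

(* [I] is the Bochner integral of [f] over [D]; this includes that [f] is
   Bochner integrable over [D]. *)
Definition is_bochner_integral D f (I : V) : Prop :=
  exists s : nat -> {fimfun T >-> V},
    [/\ forall n, integrable_simple D (s n),
        \forall t \ae mu, D t -> s n t @[n --> \oo] --> f t,
        (fun n => \int[mu]_(t in D) (`|f t - s n t|)%:E)%E @ \oo --> 0%E &
        simple_integral D (s n) @[n --> \oo] --> I].

End bochner.

(** * The space L^p([0, +oo[, U) *)

Section Lp_inputs.
Context {R : realType}.

Lemma measurable_nonnegatives :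
  measurable (nonnegatives : set (measurableTypeR R)).
Proof.
have -> : nonnegatives = `[0, +oo[%classic :> set R.
  by apply/seteqP; split=> t /=; rewrite in_itv /= andbT.
exact: measurable_itv.
Qed.

Definition lebesgue_nonneg : {measure set (measurableTypeR R) -> \bar R} :=
  mrestr (@lebesgue_measure R) measurable_nonnegatives.

Context {U : normedModType R}.

Definition Lp_enorm (p : \bar R) (u : R -> U) : \bar R :=
  'N[lebesgue_nonneg]_p[(fun t => (`|u t|)%:E)].

Definition Lp_norm (p : \bar R) (u : R -> U) : R := fine (Lp_enorm p u).

Definition Lp_inputs (p : \bar R) : set (R -> U) :=
  [set u | strongly_measurable lebesgue_nonneg u /\ (Lp_enorm p u < +oo)%E].

End Lp_inputs.

(** * Semigroups, generators, extrapolation spaces *)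

Section semigroups.
Context {R : realType}.

Record C0_semigroup (X : normedModType R) (S : R -> X -> X) : Prop := {
  semigroup_linear : forall t, 0 <= t -> linear (S t) ;
  semigroup_bounded : forall t, 0 <= t -> continuous (S t) ;
  semigroup0 : forall x, S 0 x = x ;
  semigroupD : forall s t x, 0 <= s -> 0 <= t -> S (s + t) x = S s (S t x) ;
  semigroup_continuous : forall x,
    {within nonnegatives, continuous (fun t => S t x)} }.

(* Unbounded operators are given by their graphs. *)
Definition generator (X : normedModType R) (S : R -> X -> X) : set (X * X) :=
  [set xy | h^-1 *: (S h xy.1 - xy.1) @[h --> 0^'+] --> xy.2].

(* [lambda] is in the resolvent set of [A], and [Q] = (lambda - A)^-1. *)
Definition is_resolvent (X : normedModType R) (A : set (X * X)) (lambda : R)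
    (Q : {linear X -> X}) : Prop :=
  [/\ continuous Q, forall y, A (Q y, lambda *: Q y - y) &
      forall x z, A (x, z) -> Q (lambda *: x - z) = x].

(* [Y] (with the embedding [j]) is a completion of [X] for the norm
   `|(lambda - A)^-1 x|, for some lambda in the resolvent set of [A]. *)
Definition is_extrapolation_space (X : normedModType R) (A : set (X * X))
    (Y : completeNormedModType R) (j : {linear X -> Y}) : Prop :=
  dense (range j) /\
  exists (lambda : R) (Q : {linear X -> X}),
    is_resolvent A lambda Q /\ forall x, `|j x| = `|Q x|.

Definition extends_semigroup (X Y : normedModType R) (j : X -> Y)
    (S : R -> X -> X) (Sm1 : R -> Y -> Y) : Prop :=
  forall t x, 0 <= t -> Sm1 t (j x) = j (S t x).

End semigroups.

(** * Admissible control operators *)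

Section control.
Context {R : realType} {X U : normedModType R} {Y : normedModType R}.
Variables (j : X -> Y) (Sm1 : R -> Y -> Y) (B : U -> Y).

(* The value in [X], through the embedding [j], of
   \int_0^t e^{A_{-1}(t - s)} B u(s) ds *)
Definition is_input_map (t : R) (u : R -> U) (x : X) : Prop :=
  is_bochner_integral (@lebesgue_measure R) `[0, t]
    (fun s => Sm1 (t - s) (B (u s))) (j x).

Definition admissible (Uset : set (R -> U)) : Prop :=
  forall t u, 0 <= t -> Uset u -> exists x, is_input_map t u x.

Definition input_map (t : R) (u : R -> U) : X := get (is_input_map t u).

Definition control_system (S : R -> X -> X) (p : \bar R) : input_system X U :=
  {| ident := almost_everywhere (@lebesgue_nonneg R) ;
     inputs := Lp_inputs p ;
     input_norm := Lp_norm p ;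
     flow := fun t x0 u => S t x0 + input_map t u |}.

End control.

(* Main.v *)
Require Import Defs.
From HB Require Import structures.
From mathcomp Require Import all_boot all_order all_algebra.
From mathcomp Require Import all_classical all_reals all_analysis.
From mathcomp Require Import measurable_realfun ess_sup_inf.
From mathcomp Require Import ring lra.

Set Implicit Arguments.
Unset Strict Implicit.
Unset Printing Implicit Defensive.

Import Order.TTheory GRing.Theory Num.Theory.
Import numFieldNormedType.Exports.

Local Open Scope classical_set_scope.
Local Open Scope ring_scope.

(** The equivalence of the two stability notions comes from the linearity of the
    flow, which is the sum of the orbit [S t x0] and of the input map [Phi t u].
    Applied to the zero input, the weak asymptotic gain property says that the
    orbits of [S] tend to [0]; applied to the zero state, uniform global
    stability bounds the norm of [Phi t u] by [gamma] of the norm of [u], for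
    all times.  Adding the two gives a strong asymptotic gain with the same
    [gamma], since the time after which the orbit is small depends on [x0] only.

    Most of the work is to show that the triple is a dynamical system with
    inputs.  The cocycle property and causality ([input_map_cocycle],
    [input_map_causal]) are read off the Bochner integral in the extrapolation
    space, whose uniqueness, linearity, norm bound, additivity and translation
    invariance are established first.  The continuity of the flow for finite
    exponents ([input_map_continuous]) needs the boundedness of [Phi 1] from L^p
    to [X] ([input_map_bounded]), while the integral only gives the boundedness
    into the larger extrapolation space.  This gap is closed by approximating
    the identity of [X]: with [Q] the resolvent at [lambda], the operators

      [lambda *: Q x - h^-1 *: (S h (Q x) - Q x)]

    are bounded for the norm [`|Q x|] of the extrapolation space, and they
    converge to [x] as [h] tends to [0], because [Q x] is in the domain of the
    generator ([resolvent_approx_cvg]).  Composed with [Phi 1] they form a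
    pointwise bounded sequence of bounded operators on L^p, and the principle of
    uniform boundedness applies.  That principle is proved by a gliding hump
    argument ([uniform_boundedness]), which uses the completeness of L^p only
    through the convergence of series of simple functions ([Lp_norm_series]),
    and which is combined with the density of these functions ([simple_dense]).

    Near a time [t], the flow is an orbit of [S] started shortly before [t], up
    to the effect of the input on a short interval.  The latter is small by the
    boundedness of [Phi 1] and the absolute continuity of the integral
    ([Lp_norm_cut_small]), whence continuity. *)

(** * Uniform boundedness *)

Definition seminorm_on (R : realType) (V : lmodType R) (W : set V)
    (q : V -> R) : Prop :=
  (forall u v, W u -> W v -> q (u + v) <= q u + q v) /\
  (forall (a : R) u, W u -> q (a *: u) = `|a| * q u).

Lemma seminorm_on_ge0 (R : realType) (V : lmodType R) (W : set V)
    (q : V -> R) u :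
  seminorm_on W q -> W u -> W (- u) -> 0 <= q u.
Proof.
move=> [qD qZ] Wu WNu.
have := qD _ _ Wu WNu; rewrite subrr -(scale0r u) qZ// normr0 mul0r.
by rewrite -scaleN1r qZ// normrN normr1 mul1r; lra.
Qed.

Section uniform_boundedness.
Context {R : realType} {V : lmodType R}.
(* Two sets are used because the series formed below need to converge only
   for summands in [W]: for L^p, [W] will consist of simple functions. *)
Variables (W W' : set V) (N : V -> R).
Hypothesis WW' : W `<=` W'.
Hypothesis WZ : forall (a : R) u, W u -> W (a *: u).
Hypothesis W'D : forall (a : R) u v, W' u -> W' v -> W' (a *: u + v).
Hypothesis Nseminorm : seminorm_on W' N.
Hypothesis Nseries : forall v : nat -> V, (forall k, W (v k)) ->
  (forall k, N (v k) <= 2^-1 ^+ k) ->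
  exists2 u, W' u & forall n c,
    (forall m, (n <= m)%N -> N (\sum_(n <= k < m) v k) <= c) ->
    N (u - \sum_(0 <= k < n) v k) <= c.
Variables (I : Type) (q : I -> V -> R) (c : I -> R).
Hypothesis qseminorm : forall i, seminorm_on W' (q i).
Hypothesis q_le : forall i u, W' u -> q i u <= c i * N u.
Hypothesis q_bounded : forall u, W' u -> exists M, forall i, q i u <= M.

Let W'0 u : W' u -> W' 0.
Proof. by move=> Wu; have := W'D (-1) Wu Wu; rewrite scaleN1r addNr. Qed.

Let W'Z a u : W' u -> W' (a *: u).
Proof. by move=> Wu; rewrite -[_ *: _]addr0; apply: W'D => //;
  exact: W'0 Wu. Qed.

Let W'N u : W' u -> W' (- u).
Proof. by rewrite -scaleN1r; exact: W'Z. Qed.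

Let W'A u v : W' u -> W' v -> W' (u + v).
Proof. by move=> Wu Wv; rewrite -[u]scale1r; exact: W'D. Qed.

Let N_ge0 u : W' u -> 0 <= N u.
Proof. by move=> Wu; apply: seminorm_on_ge0 Nseminorm _ _ => //;
  exact: W'N. Qed.

(** One of the two points [S + w] and [S - w] is at least as large as [w] for
    any seminorm, so a hump can be added to a partial sum without being
    cancelled by it. *)
Let hump n a S : (forall C : R, exists i u, W u /\ C * N u < q i u) ->
  0 < a -> W' S ->
  exists iv : I * V, [/\ W iv.2, N iv.2 <= a * 2^-1 ^+ n &
    n.+1%:R <= q iv.1 (S + iv.2)].
Proof.
move=> unb a0 WS.
set e := a * 2^-1 ^+ n.
have e0 : 0 < e by rewrite mulr_gt0// exprn_gt0.
have [i [u [Wu qu]]] := unb (n.+1%:R / e).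
have W'u := WW' Wu.
have Nu : 0 < N u.
  rewrite lt_neqAle N_ge0// andbT eq_sym; apply/eqP => Nu0.
  by move: qu; have := q_le i W'u; rewrite Nu0 !mulr0 => /le_lt_trans/[apply];
    rewrite ltxx.
pose w := (e / N u) *: u.
have Ww : W w by exact: WZ.
have W'w := WW' Ww.
have Nw : N w = e.
  by rewrite (Nseminorm.2 _ _ W'u) gtr0_norm ?divr_gt0// divfK// gt_eqF.
have qw : n.+1%:R <= q i w.
  rewrite ((qseminorm i).2 _ _ W'u) gtr0_norm ?divr_gt0//.
  have -> : n.+1%:R = e / N u * (n.+1%:R / e * N u) :> R.
    by field; rewrite !gt_eqF.
  by rewrite ler_wpM2l ?ltW// divr_gt0.
have [le1|lt1] := leP n.+1%:R (q i (S + w)).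
  by exists (i, w); split => //=; rewrite Nw.
exists (i, - w); split => /=.
- by rewrite -scaleN1r; exact: WZ.
- by rewrite -scaleN1r (Nseminorm.2 _ _ W'w) normrN normr1 mul1r Nw.
have := (qseminorm i).1 _ _ (W'A WS W'w) (W'N (W'A WS (W'N W'w))).
have -> : S + w + - (S - w) = 2 *: w.
  by rewrite opprB addrC addrA subrK scaler_nat mulr2n.
rewrite ((qseminorm i).2 _ _ W'w) -scaleN1r.
rewrite ((qseminorm i).2 _ _ (W'A WS (W'N W'w))) normrN normr1 mul1r.
by rewrite gtr0_norm//; lra.
Qed.

(** A gliding hump: if the seminorms were not uniformly bounded, the series of
    successive humps would converge to a point where they are unbounded.  The
    budget [a] left for the next humps is divided by [1 + `|c i|] once the
    seminorm [q i] has been used, so that the tail of the series is negligible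
    for [q i]. *)
Lemma uniform_boundedness :
  exists C, forall i u, W u -> q i u <= C * N u.
Proof.
apply: contrapT => nb.
have unb (C : R) : exists i u, W u /\ C * N u < q i u.
  apply: contrapT => h; apply: nb; exists C => i u Wu.
  by rewrite leNgt; apply/negP => lt; apply: h; exists i, u.
have [i0 [u0 [Wu0 _]]] := unb 0.
have /choice[f fP] : forall x : nat * R * V, exists iv : I * V,
    0 < x.1.2 -> W' x.2 -> [/\ W iv.2, N iv.2 <= x.1.2 * 2^-1 ^+ x.1.1 &
    x.1.1.+1%:R <= q iv.1 (x.2 + iv.2)].
  move=> [[n a] S]/=; have [a0|na] := pselect (0 < a); last first.
    by exists (i0, u0) => /na.
  have [WS|nS] := pselect (W' S); last by exists (i0, u0) => _ /nS.
  by have [iv h] := hump n unb a0 WS; exists iv.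
pose st := fix st n : R * V := if n is m.+1 then
    let x := st m in let iv := f (m, x.1, x.2) in
    (x.1 / (1 + `|c iv.1|), x.2 + iv.2)
  else (1, 0).
pose a n := (st n).1; pose S n := (st n).2.
pose ix n := (f (n, a n, S n)).1; pose v n := (f (n, a n, S n)).2.
have aS n : a n.+1 = a n / (1 + `|c (ix n)|) by [].
have SS n : S n.+1 = S n + v n by [].
have c1 i : 1 <= 1 + `|c i| by rewrite lerDl.
have c0 i : 0 < 1 + `|c i| by exact: lt_le_trans (c1 i).
have inv n : 0 < a n <= 1 /\ W' (S n).
  elim: n => [|n [/andP[an0 an1] WSn]].
    by rewrite ltr01 lexx; split => //; exact: W'0 (WW' Wu0).
  rewrite aS SS; split.
    by rewrite divr_gt0//= ler_pdivrMr// mul1r (le_trans an1).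
  by have [/WW' Wv _ _] := fP (n, a n, S n) an0 WSn; exact: W'A.
have vP n : [/\ W (v n), N (v n) <= a n * 2^-1 ^+ n &
    n.+1%:R <= q (ix n) (S n.+1)].
  by have [/andP[an0 _] WSn] := inv n; exact: (fP (n, a n, S n)).
have S_sum n : S n = \sum_(0 <= k < n) v k.
  by elim: n => [|n IH]; [rewrite big_geq|rewrite big_nat_recr//= SS IH].
have a_noninc n m : (n <= m)%N -> a m <= a n.
  elim: m => [|m IH]; first by rewrite leqn0 => /eqP->.
  rewrite leq_eqVlt => /orP[/eqP->//|]; rewrite ltnS => /IH; apply: le_trans.
  have [/andP[am0 _] _] := inv m.
  by rewrite aS ler_pdivrMr// ler_peMr// ltW.
have W'sum n m : W' (\sum_(n <= k < m) v k).
  apply: (big_ind W'); [exact: W'0 (WW' Wu0)|exact: W'A|].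
  by move=> k _; have [/WW'] := vP k.
have tail n m : (n <= m)%N ->
    N (\sum_(n <= k < m) v k) <= a n * (2 * 2^-1 ^+ n - 2 * 2^-1 ^+ m).
  elim: m => [|m IH].
    rewrite leqn0 => /eqP->; rewrite big_geq// subrr mulr0.
    by rewrite -(scale0r u0) (Nseminorm.2 _ _ (WW' Wu0)) normr0 mul0r.
  rewrite leq_eqVlt => /orP[/eqP->|].
    rewrite big_geq// subrr mulr0.
    by rewrite -(scale0r u0) (Nseminorm.2 _ _ (WW' Wu0)) normr0 mul0r.
  rewrite ltnS => nm; rewrite big_nat_recr//=.
  have [/WW' Wv Nv _] := vP m.
  apply: (le_trans (Nseminorm.1 _ _ (W'sum _ _) Wv)).
  have := IH nm; have := a_noninc _ _ nm.
  have e0 : 0 <= 2^-1 ^+ m :> R by rewrite exprn_ge0.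
  move=> /(ler_wpM2r e0); rewrite exprS; nra.
have [||u Wu uP] := Nseries (v := v).
- by move=> k; have [] := vP k.
- move=> k; have [_ + _] := vP k; have [/andP[_ a1] _] := inv k.
  by move=> /le_trans; apply; rewrite ler_piMl// exprn_ge0.
have [M qM] := q_bounded Wu.
suff : forall n : nat, n%:R <= M.
  by move=> /(_ (Num.truncn M).+1); rewrite leNgt truncnS_gt.
move=> n; apply: le_trans (qM (ix n)).
have [/andP[an0 an1] WSn] := inv n; have [/andP[am0 _] WSm] := inv n.+1.
have W'd : W' (u - S n.+1) by apply: W'A => //; exact: W'N.
have Nd : N (u - S n.+1) <= a n.+1.
  rewrite S_sum; apply: uP => m nm; apply: (le_trans (tail _ _ nm)).
  rewrite ler_piMr ?(ltW am0)// exprS mulrA divff// mul1r.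
  have : 2^-1 ^+ n <= 1 :> R by rewrite exprn_ile1// invf_le1// ler1n.
  have : 0 <= 2^-1 ^+ m :> R by rewrite exprn_ge0.
  move: (2^-1 ^+ n) (2^-1 ^+ m) => x y; lra.
have qd : q (ix n) (u - S n.+1) <= 1.
  apply: (le_trans (q_le _ W'd)).
  apply: (@le_trans _ _ (`|c (ix n)| * a n.+1)).
    rewrite (le_trans (ler_norm _))// normrM ler_wpM2l// ger0_norm//.
    exact: N_ge0.
  rewrite aS mulrA ler_pdivrMr// mul1r (@le_trans _ _ `|c (ix n)|)//.
    by rewrite ler_piMr.
  by rewrite lerDr.
have [_ _] := vP n.
have := (qseminorm (ix n)).1 _ _ Wu (W'N W'd).
rewrite opprB addrC subrK -(opprB u) -scaleN1r.
rewrite ((qseminorm _).2 _ _ W'd) normrN normr1 mul1r -natr1; lra.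
Qed.

End uniform_boundedness.

(** * Integrals of nonnegative functions *)

Section nonnegative_integrals.
Context {d : measure_display} {T : measurableType d} {R : realType}.
Variable mu : {measure set T -> \bar R}.
Local Open Scope ereal_scope.
Import HBNNSimple.

(** The integral of a nonnegative function is a supremum over the simple
    functions below it, and setting a simple function to [0] on a null set does
    not change its integral.  The comparison thus covers the norms of strongly
    measurable functions, which are measurable only up to a null set. *)
Lemma ge0_ae_le_integral_nonmeas (D : set T) (f g : T -> \bar R) :
  (forall t, D t -> 0 <= f t) -> (forall t, D t -> 0 <= g t) ->
  (\forall t \ae mu, D t -> f t <= g t) ->
  \int[mu]_(t in D) f t <= \int[mu]_(t in D) g t.
Proof.
move=> f0 g0 [N [mN N0 sN]]; rewrite !ge0_integralE//.
apply: ub_ereal_sup => _ [h /= hf <-].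
pose h' := proj_nnsfun h (measurableC mN).
have h'E t : h' t = (h t * \1_(~` N) t)%R by [].
have -> : sintegral mu h = sintegral mu h'.
  have sE (k : {nnsfun T >-> R}) : sintegral mu k = \int[mu]_t (k t)%:E.
    rewrite integral_nnsfun//; congr sintegral; apply/funext => t.
    by rewrite patchE in_setT.
  rewrite !sE.
  apply: ae_eq_integral => //; [exact/measurable_EFinP|exact/measurable_EFinP|].
  exists N; split => // t /= ht; apply: contrapT => Nt; apply: ht => _.
  by rewrite /= /mindic indicE mem_set// mulr1.
apply: ereal_sup_ubound; exists h' => // t; rewrite h'E indicE.
have [Nt|Nt] := pselect (N t).
  by rewrite memNset ?mulr0 ?patchE//; case: ifPn => // /set_mem /g0.
rewrite mem_set// mulr1; apply: (le_trans (hf t)); rewrite !patchE.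
case: ifPn => // /set_mem Dt; apply: contrapT => fg; apply: Nt;
  apply: sN => /= h1.
by apply: fg; exact: h1.
Qed.

Lemma ge0_ae_eq_integral_nonmeas (D : set T) (f g : T -> \bar R) :
  (forall t, D t -> 0 <= f t) -> (forall t, D t -> 0 <= g t) ->
  (\forall t \ae mu, D t -> f t = g t) ->
  \int[mu]_(t in D) f t = \int[mu]_(t in D) g t.
Proof.
move=> f0 g0 fg; apply/eqP; rewrite eq_le; apply/andP.
by split; apply: ge0_ae_le_integral_nonmeas => //;
  apply: filterS fg => t /[apply] ->.
Qed.

End nonnegative_integrals.

(** * Simple functions and their limits *)

Section simple_functions.
Context {d : measure_display} {T : measurableType d}.

(** The codomain is an arbitrary type, so that a pair of simple functions, or a
    simple function together with a membership test, is again simple. *)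
Definition simple (W : Type) (w : T -> W) : Prop :=
  finite_set (range w) /\ forall c, measurable (w @^-1` [set c]).

Lemma simple_preimage (W : choiceType) (w : T -> W) (A : set W) :
  simple w -> measurable (w @^-1` A).
Proof.
move=> [fw mw].
rewrite (_ : _ @^-1` _ = \bigcup_(c in range w `&` A) (w @^-1` [set c])).
  by apply: fin_bigcup_measurable => //; exact: finite_setIl.
apply/seteqP; split=> [t At|t [c [_ Ac] /= wt]]; last by rewrite /preimage/= wt.
by exists (w t) => //; split => //; exists t.
Qed.

Lemma simple_comp (W : choiceType) (Z : Type) (w : T -> W) (g : W -> Z) :
  simple w -> simple (g \o w).
Proof.
move=> sw; split.
  apply: (@sub_finite_set _ _ (g @` range w)); last exact: finite_image sw.1.
  by move=> _ [t _ <-]; exists (w t) => //; exists t.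
by move=> c; rewrite comp_preimage; exact: simple_preimage.
Qed.

Lemma simple_pair (W Z : Type) (w : T -> W) (z : T -> Z) :
  simple w -> simple z -> simple (fun t => (w t, z t)).
Proof.
move=> [fw mw] [fz mz]; split.
  apply: (@sub_finite_set _ _ (range w `*` range z)); last exact: finite_setX.
  by move=> _ [t _ <-]; split; exists t.
move=> [a b]; rewrite (_ : _ @^-1` _ = w @^-1` [set a] `&` z @^-1` [set b]).
  exact: measurableI.
by apply/seteqP; split=> t /=; [case=> <- <-|case=> <- <-].
Qed.

Lemma simple_cst (W : Type) (c : W) : simple (fun _ : T => c).
Proof.
split.
  by apply: (@sub_finite_set _ _ [set c]) => [_ [t _ <-]|]//;
    exact: finite_set1.
move=> c'; have [->|n] := pselect (c = c').
  by rewrite (_ : _ @^-1` _ = setT)//; apply/seteqP; split.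
by rewrite (_ : _ @^-1` _ = set0)//; apply/seteqP; split.
Qed.

Lemma simple_mem (A : set T) : measurable A -> simple (fun t => t \in A).
Proof.
move=> mA; split; first exact: finite_finset.
case.
  rewrite (_ : _ @^-1` _ = A)//; apply/seteqP; split=> t /=.
    by move=> /set_mem.
  by move=> /mem_set.
rewrite (_ : _ @^-1` _ = ~` A); first exact: measurableC.
by apply/seteqP; split=> t /=; [move=> /negbT /negP;
  rewrite inE|exact: memNset].
Qed.

Lemma simple_comp_measurable (W : Type) (w : T -> W) (phi : T -> T) :
  measurable_fun setT phi -> simple w -> simple (w \o phi).
Proof.
move=> mphi [fw mw]; split.
  by apply: sub_finite_set fw => _ [t _ <-]; exists (phi t).
by move=> c; rewrite comp_preimage -[X in measurable X]setTI; exact: mphi.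
Qed.

Lemma simple_measurable {R : realType} (w : T -> R) :
  simple w -> measurable_fun setT w.
Proof. by move=> sw _ A _; rewrite setTI; exact: simple_preimage. Qed.

Lemma simple_fimfun (W : Type) (w : T -> W) : simple w ->
  exists s : {fimfun T >-> W}, s = w :> (T -> W).
Proof.
move=> [fw _].
pose m : @FiniteImage T W w := @FiniteImage.Build T W w fw.
by exists (HB.pack_for {fimfun T >-> W} w m).
Qed.

End simple_functions.

Section simple_limits.
Context {d : measure_display} {T : measurableType d} {R : realType}.

(** Strongly measurable functions are modified on a null set so as to become
    limits of simple functions everywhere; this makes their norms measurable
    for the given sigma-algebra, where null sets need not be measurable. *)
Definition simple_limit (V : normedModType R) (f : T -> V) : Prop :=
  exists2 s : nat -> T -> V, (forall n, simple (s n)) &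
    forall t, s n t @[n --> \oo] --> f t.

Lemma simple_simple_limit (V : normedModType R) (f : T -> V) :
  simple f -> simple_limit f.
Proof. by move=> sf; exists (fun=> f) => // t; exact: cvg_cst. Qed.

Lemma simple_limit_linear (V : normedModType R) (a : R) (f g : T -> V) :
  simple_limit f -> simple_limit g -> simple_limit (fun t => a *: f t + g t).
Proof.
move=> [s ss sf] [r sr rg]; exists (fun n t => a *: s n t + r n t).
  move=> n; have := simple_comp (fun c => a *: c.1 + c.2) (simple_pair (ss n)
    (sr n)).
  by [].
by move=> t; apply: cvgD => //; apply: cvgZr.
Qed.

Lemma simple_limitD (V : normedModType R) (f g : T -> V) :
  simple_limit f -> simple_limit g -> simple_limit (fun t => f t + g t).
Proof.
move=> sf sg; have := simple_limit_linear 1 sf sg.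
by congr simple_limit; apply/funext => t; rewrite scale1r.
Qed.

Lemma simple_limitZ (V : normedModType R) (a : R) (f : T -> V) :
  simple_limit f -> simple_limit (fun t => a *: f t).
Proof.
move=> sf; have := simple_limit_linear a sf (simple_simple_limit (simple_cst
  0)).
by congr simple_limit; apply/funext => t; rewrite addr0.
Qed.

Lemma simple_limitB (V : normedModType R) (f g : T -> V) :
  simple_limit f -> simple_limit g -> simple_limit (fun t => f t - g t).
Proof.
move=> sf sg; have := simple_limitD sf (simple_limitZ (-1) sg).
by congr simple_limit; apply/funext => t; rewrite scaleN1r.
Qed.

Lemma simple_limit_if (V : normedModType R) (A : set T) (f g : T -> V) :
  measurable A -> simple_limit f -> simple_limit g ->
  simple_limit (fun t => if t \in A then f t else g t).
Proof.
move=> mA [s ss sf] [r sr rg]; exists (fun n t => if t \in A then s n t else r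
  n t).
  move=> n; have := simple_comp (fun c : bool * (V * V) => if c.1 then c.2.1
    else c.2.2)
    (simple_pair (simple_mem mA) (simple_pair (ss n) (sr n))).
  by [].
by move=> t; case: ifPn.
Qed.

Lemma simple_limit_comp_measurable (V : normedModType R) (f : T -> V)
    (phi : T -> T) :
  measurable_fun setT phi -> simple_limit f -> simple_limit (f \o phi).
Proof.
move=> mphi [s ss sf]; exists (fun n => s n \o phi).
  by move=> n; exact: simple_comp_measurable.
by move=> t; exact: sf.
Qed.

Lemma simple_limit_measurable_norm (V : normedModType R) (f : T -> V) :
  simple_limit f -> measurable_fun setT (fun t => `|f t|).
Proof.
move=> [s ss sf]; apply: (measurable_fun_cvg (h := fun n t => `|s n t|)).
  by move=> n; apply: simple_measurable; exact: (simple_comp (fun v : V =>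
    `|v|) (ss n)).
by move=> t _; apply: cvg_norm; exact: sf.
Qed.

Section strongly_measurable.
Variable mu : {measure set T -> \bar R}.

Lemma strongly_measurableP (V : normedModType R) (f : T -> V) :
  strongly_measurable mu f <->
  exists2 g, simple_limit g & \forall t \ae mu, f t = g t.
Proof.
split=> [[s ms [N [mN N0 sN]]]|[g [s ss sg] fg]].
  exists (fun t => if t \in N then 0 else f t).
    exists (fun n t => if t \in N then 0 else s n t) => [n|t].
      have := simple_comp (fun c : bool * V => if c.1 then 0 else c.2)
        (simple_pair (simple_mem mN) (conj (fimfunP (s n)) (ms n))).
      by [].
    case: ifPn => [_|/negP Nt]; first exact: cvg_cst.
    apply: contrapT => h; apply: Nt; apply/mem_set; apply: sN => /=.
    by move=> h'; apply: h.
  exists N; split => // t /= h; apply: contrapT => Nt; apply: h.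
  by rewrite memNset.
have /choice[s' s'E] := fun n => simple_fimfun (ss n).
exists s'; first by move=> n v; rewrite s'E; exact: (ss n).2.
apply: filterS fg => t ->.
by under eq_fun do rewrite s'E; exact: sg.
Qed.

End strongly_measurable.

End simple_limits.

(** * The Bochner integral *)

Section simple_integrals.
Context {d : measure_display} {T : measurableType d} {R : realType}.
Variables (mu : {measure set T -> \bar R}) (D : set T).
Hypotheses (mD : measurable D) (Dfin : (mu D < +oo)%E).

(** The same sum as [simple_integral], on plain functions, so that it applies
    directly to compositions. *)
Definition sint (V : normedModType R) (f : T -> V) : V :=
  \sum_(v \in range f) fine (mu (D `&` f @^-1` [set v])) *: v.

Let fin_mu A : measurable A -> mu (D `&` A) \is a fin_num.
Proof.
move=> mA; rewrite ge0_fin_numE//; apply: le_lt_trans Dfin.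
by apply: le_measure; rewrite ?inE//; exact: measurableI.
Qed.

(** The change of variables formula for simple functions.  Applied to pairs, it
    expresses the integrals of several simple functions as sums over the same
    partition, which is how linearity is obtained below. *)
Lemma sint_comp (W : choiceType) (V : normedModType R) (w : T -> W) (g : W ->
  V) :
  simple w ->
  sint (g \o w) = \sum_(c \in range w) fine (mu (D `&` w @^-1` [set c])) *: g c.
Proof.
move=> sw; have sgw := simple_comp g sw.
rewrite /sint fsbig_finite; last exact: sgw.1.
rewrite fsbig_finite; last exact: sw.1.
set F := finmap.enum_fset (fset_set (range (g \o w))).
set G := finmap.enum_fset (fset_set (range w)).
have memF v : (v \in F) = (v \in range (g \o w)) by exact: in_fset_set sgw.1 _.
have memG c : (c \in G) = (c \in range w) by exact: in_fset_set sw.1 _.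
transitivity (\sum_(c <- G) \sum_(v <- F | v == g c)
    fine (mu (D `&` w @^-1` [set c])) *: v); last first.
  rewrite [LHS]big_seq [RHS]big_seq; apply: eq_bigr => c cG.
  have gcF : g c \in F.
    by move: cG; rewrite memG memF !inE => -[t _ <-]; exists t.
  rewrite big_mkcond/= (bigD1_seq (g c))//= ?finmap.fset_uniq// eqxx big1
    ?addr0// => v /negbTE vg.
  by rewrite vg.
rewrite (exchange_big_dep xpredT)//=; apply: eq_bigr => v _.
rewrite -scaler_suml; congr (_ *: _).
rewrite sum_fine; last by move=> c _; apply: fin_mu; exact: sw.2.
congr fine.
rewrite (_ : D `&` _ = \bigcup_(c in range w `&` [set c | v == g c])
    (D `&` w @^-1` [set c])); last first.
  apply/seteqP; split=> [t [Dt /= gwt]|t [c [_ /= /eqP vg] [Dt /= wt]]].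
    by exists (w t) => //; split; [exists t|rewrite /= -gwt].
  by split => //=; rewrite wt vg.
rewrite measure_fin_bigcup/=.
- rewrite fsbig_mkcondr fsbig_finite; last exact: sw.1.
  rewrite [RHS]big_mkcond/=; apply: eq_bigr => c _.
  by rewrite (_ : (c \in _) = (v == g c))//; apply/idP/idP; rewrite inE.
- exact: finite_setIl sw.1.
- by move=> c c' _ _ [t [[_ /= <-] [_ /= <-]]].
- by move=> c _; apply: measurableI => //; exact: sw.2.
Qed.

(** The fibres over the points outside the range are empty. *)
Lemma sint_widen (V : normedModType R) (f : T -> V) (A : set V) :
  range f `<=` A ->
  sint f = \sum_(v \in A) fine (mu (D `&` f @^-1` [set v])) *: v.
Proof.
move=> fA; apply: fsbig_widen => // v [_ fv] /=.
rewrite (_ : _ `&` _ = set0) ?measure0 ?scale0r//.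
by apply/seteqP; split => // t [_ /= ftv]; apply: fv; exists t.
Qed.

Lemma sint_linear (V : normedModType R) (a : R) (f g : T -> V) :
  simple f -> simple g ->
  sint (fun t => a *: f t + g t) = a *: sint f + sint g.
Proof.
move=> sf sg; have sfg := simple_pair sf sg.
have E (h : V * V -> V) := sint_comp h sfg.
rewrite (E (fun c => a *: c.1 + c.2) : sint (fun t => a *: f t + g t) = _).
rewrite (E (fun c => c.1) : sint f = _) (E (fun c => c.2) : sint g = _).
rewrite !fsbig_finite; try exact: sfg.1.
rewrite scaler_sumr -big_split; apply: eq_bigr => c _ /=.
by rewrite scalerDr !scalerA mulrC.
Qed.

Lemma sint_linear_map (V V' : normedModType R) (L : {linear V -> V'})
    (f : T -> V) :
  simple f -> sint (L \o f) = L (sint f).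
Proof.
move=> sf; rewrite sint_comp// /sint !fsbig_finite; try exact: sf.1.
by rewrite linear_sum; apply: eq_bigr => c _; rewrite linearZ.
Qed.

Lemma sint_ae_eq (V : normedModType R) (f g : T -> V) :
  simple f -> simple g -> (\forall t \ae mu, D t -> f t = g t) ->
  sint f = sint g.
Proof.
move=> sf sg [N [mN N0 sN]]; have sfg := simple_pair sf sg.
have E (h : V * V -> V) := sint_comp h sfg.
rewrite (E (fun c => c.1) : sint f = _) (E (fun c => c.2) : sint g = _).
apply: eq_fsbigr => -[a b] _ /=.
have [->//|nab] := pselect (a = b).
have -> : mu (D `&` (fun t => (f t, g t)) @^-1` [set (a, b)]) = 0%E.
  apply: (@subset_measure0 _ _ _ mu _ N) => //.
    by apply: measurableI => //; exact: sfg.2.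
  move=> t [Dt /= [fa gb]]; apply: sN => /= /(_ Dt).
  by rewrite fa gb.
by rewrite !scale0r.
Qed.

Lemma integral_norm_simple (V : normedModType R) (f : T -> V) : simple f ->
  (\int[mu]_(t in D) (`|f t|)%:E =
   (\sum_(v \in range f) fine (mu (D `&` f @^-1` [set v])) * `|v|)%:E)%E.
Proof.
move=> sf.
transitivity (\int[mu]_(t in D) (\sum_(v \in range f)
    (`|v| * \1_(f @^-1` [set v]) t)%:E))%E.
  apply: eq_integral => t _; rewrite (fsbigD1 (f t))//=; last first.
  - by exists t.
  - exact: sf.1.
  rewrite indicE mem_set// mulr1 fsbig1 ?adde0// => v [_ /= vf].
  by rewrite indicE memNset ?mulr0// => /= ftv; apply: vf.
have mh v : measurable_fun D (fun t => (`|v| * \1_(f @^-1` [set v]) t)%:E).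
  apply/measurable_EFinP; apply: measurable_funM => //.
  by apply: measurable_indic; exact: sf.2.
have h0 v t : D t -> (0 <= (`|v| * \1_(f @^-1` [set v]) t)%:E)%E.
  by move=> _; rewrite lee_fin mulr_ge0.
rewrite (ge0_integral_fsum mu mD mh h0 sf.1).
rewrite -fsumEFin; last exact: sf.1.
apply: eq_fsbigr => v _; have mv : measurable (f @^-1` [set v]) by exact: sf.2.
under eq_integral do rewrite EFinM.
rewrite ge0_integralZl_EFin//; last first.
  by apply/measurable_EFinP; exact: measurable_indic.
rewrite integral_indic// EFinM muleC; congr (_ * _)%E.
by rewrite setIC fineK// fin_mu.
Qed.

Lemma sint_norm (V : normedModType R) (f : T -> V) : simple f ->
  ((`|sint f|)%:E <= \int[mu]_(t in D) (`|f t|)%:E)%E.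
Proof.
move=> sf; rewrite integral_norm_simple// lee_fin /sint.
rewrite !fsbig_finite; try exact: sf.1.
apply: (le_trans (ler_norm_sum _ _ _)); apply: ler_sum => v _.
by rewrite normrZ ger0_norm// fine_ge0.
Qed.

End simple_integrals.

Section bochner_integral.
Context {d : measure_display} {T : measurableType d} {R : realType}.
Variable mu : {measure set T -> \bar R}.

(** A normal form of [is_bochner_integral]: the simple functions converge
    everywhere, which makes the functions [`|f t - s n t|] measurable. *)
Definition limit_bochner (V : normedModType R) (D : set T) (f : T -> V) (I : V)
  :=
  exists s : nat -> T -> V, [/\ forall n, simple (s n),
    forall t, s n t @[n --> \oo] --> f t,
    (fun n => \int[mu]_(t in D) (`|f t - s n t|)%:E)%E @ \oo --> 0%E &
    sint mu D (s n) @[n --> \oo] --> I].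

Section finite_domain.
Variable D : set T.
Hypotheses (mD : measurable D) (Dfin : (mu D < +oo)%E).

(** The simple functions are set to [0] outside [D] and on the null set where
    they do not converge; this changes neither their integrals over [D] nor
    those of the errors. *)
Lemma is_bochner_integralP (V : normedModType R) (f : T -> V) I :
  is_bochner_integral mu D f I <->
  exists2 g, (\forall t \ae mu, D t -> f t = g t) & limit_bochner D g I.
Proof.
split=> [[s [si [N [mN N0 sN]] sI ssI]]|[g fg [s [ss sg sI ssI]]]].
  pose h (v : T -> V) t : V := if t \in N `|` ~` D then 0 else v t.
  have mh : measurable (N `|` ~` D) by apply: measurableU => //;
    exact: measurableC.
  have hE v t : ~ N t -> D t -> h v t = v t.
    by move=> Nt Dt; rewrite /h memNset//=; case.
  have ae_h v : \forall t \ae mu, D t -> v t = h v t.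
    exists N; split => // t /= H; apply: contrapT => Nt; apply: H => Dt.
    by rewrite hE.
  have ssim n : simple (s n) by split; [exact: fimfunP|exact: (si n).1].
  exists (h f); first exact: ae_h.
  exists (fun n => h (s n)).
  have hsim n : simple (h (s n)).
    have := simple_comp (fun c : bool * V => if c.1 then 0 else c.2)
      (simple_pair (simple_mem mh) (ssim n)).
    by [].
  split => //.
  - move=> t; rewrite /h; case: ifPn => [_|]; first exact: cvg_cst.
    move=> /negP nt; apply: contrapT => H; apply: nt; apply/mem_set.
    have [Dt|] := pselect (D t); last by right.
    by left; apply: sN => /= H'; apply: H; exact: H'.
  - apply: cvg_trans sI; apply: near_eq_cvg; apply: nearW => n.
    apply: ge0_ae_eq_integral_nonmeas => //.
    have := ae_h f; apply: filterS2 (ae_h (s n)) => t Hs Hf Dt.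
    by rewrite Hs// Hf.
  - apply: cvg_trans ssI; apply: near_eq_cvg; apply: nearW => n.
    exact: sint_ae_eq.
have /choice[s' s'E] := fun n => simple_fimfun (ss n).
exists s'; split.
- move=> n; have ms : measurable_simple (s' n) by move=> v; rewrite s'E;
  exact: (ss n).2.
  split=> // v _; apply: le_lt_trans Dfin.
  by apply: le_measure; rewrite ?inE//; apply: measurableI => //; exact: ms.
- apply: filterS fg => t fg Dt; rewrite fg//.
  by under eq_fun do rewrite s'E; exact: sg.
- apply: cvg_trans sI; apply: near_eq_cvg; apply: nearW => n.
  apply: ge0_ae_eq_integral_nonmeas => //.
  by apply: filterS fg => t fg Dt; rewrite s'E fg.
- apply: cvg_trans ssI; apply: near_eq_cvg; apply: nearW => n.
  by rewrite /simple_integral s'E.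
Qed.

Let measurable_norm (V : normedModType R) (f : T -> V) : simple_limit f ->
  measurable_fun D (fun t => (`|f t|)%:E).
Proof.
move=> sf; apply/measurable_EFinP; apply: measurable_funTS.
exact: simple_limit_measurable_norm.
Qed.

Lemma limit_bochner_linear (V : normedModType R) (a : R) (f g : T -> V) I J :
  limit_bochner D f I -> limit_bochner D g J ->
  limit_bochner D (fun t => a *: f t + g t) (a *: I + J).
Proof.
move=> [s [ss sf sI ssI]] [r [sr rg rI srI]].
have lf : simple_limit f by exists s.
have lg : simple_limit g by exists r.
exists (fun n t => a *: s n t + r n t); split.
- move=> n; have := simple_comp (fun c => a *: c.1 + c.2) (simple_pair (ss n)
  (sr n)).
  by [].
- by move=> t; apply: cvgD => //; apply: cvgZr.
- have mfs n : measurable_fun D (fun t => (`|f t - s n t|)%:E).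
    by apply: measurable_norm; apply: simple_limitB => //;
      exact: simple_simple_limit.
  have mgr n : measurable_fun D (fun t => (`|g t - r n t|)%:E).
    by apply: measurable_norm; apply: simple_limitB => //;
      exact: simple_simple_limit.
  apply: (@squeeze_cvge _ _ _ _ (cst 0%E) _ (fun n => `|a|%:E *
      (\int[mu]_(t in D) (`|f t - s n t|)%:E) +
      \int[mu]_(t in D) (`|g t - r n t|)%:E)%E).
  + apply: nearW => n; rewrite integral_ge0//= -ge0_integralZl_EFin//.
    rewrite -ge0_integralD//; last by apply: measurable_funeM.
    apply: ge0_ae_le_integral_nonmeas => //.
      by move=> t _; rewrite -EFinM -EFinD lee_fin addr_ge0// mulr_ge0.
    apply: aeW => t _; rewrite -EFinM -EFinD lee_fin -normrZ scalerBr.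
    by rewrite opprD addrACA ler_normD.
  + exact: cvg_cst.
  + rewrite -[X in _ --> X](_ : `|a|%:E * 0 + 0 = 0)%E;
    last by rewrite mule0 adde0.
    apply: cvgeD => //.
    by apply: cvgeZl.
- under eq_fun do rewrite sint_linear//.
  by apply: cvgD => //; apply: cvgZr.
Qed.

Lemma limit_bochner_linear_map (V V' : normedModType R) (L : {linear V -> V'})
    (f : T -> V) I :
  continuous L -> limit_bochner D f I -> limit_bochner D (L \o f) (L I).
Proof.
move=> cL [s [ss sf sI ssI]].
have lf : simple_limit f by exists s.
have [M M0 LM] : exists2 M : R, 0 < M & forall v, `|L v| <= M * `|v|.
  have /linear_boundedP[M [_ LM]] : bounded_near L (nbhs 0).
    by apply/linear_bounded_continuous.
  exists (`|M| + 1); first by rewrite ltr_wpDl.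
  by apply: LM; rewrite ltr_pwDr// ler_norm.
exists (fun n => L \o s n); split.
- by move=> n; exact: simple_comp.
- by move=> t /=; apply: continuous_cvg; [exact: cL|exact: sf].
- apply: (@squeeze_cvge _ _ _ _ (cst 0%E) _ (fun n => M%:E *
      (\int[mu]_(t in D) (`|f t - s n t|)%:E))%E).
  + apply: nearW => n; rewrite integral_ge0//= -ge0_integralZl_EFin ?(ltW
    M0)//; last first.
      by apply: measurable_norm; apply: simple_limitB => //;
        exact: simple_simple_limit.
    apply: ge0_ae_le_integral_nonmeas => //.
      by move=> t _; rewrite -EFinM lee_fin mulr_ge0// ltW.
    by apply: aeW => t _; rewrite -EFinM lee_fin -linearB.
  + exact: cvg_cst.
  + by rewrite -[X in _ --> X](mule0 M%:E); apply: cvgeZl.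
- under eq_fun do rewrite sint_linear_map//.
  by apply: continuous_cvg; first exact: cL.
Qed.

(** The bound holds for each simple function up to the integral of the error,
    which tends to [0]. *)
Lemma limit_bochner_norm (V : normedModType R) (f : T -> V) I :
  limit_bochner D f I -> ((`|I|)%:E <= \int[mu]_(t in D) (`|f t|)%:E)%E.
Proof.
move=> [s [ss sf sI ssI]].
have lf : simple_limit f by exists s.
have f0 : (0 <= \int[mu]_(t in D) (`|f t|)%:E)%E by exact: integral_ge0.
have [->|ffin] := eqVneq (\int[mu]_(t in D) (`|f t|)%:E)%E +oo%E.
  by rewrite leey.
have /fineK ffE : (\int[mu]_(t in D) (`|f t|)%:E)%E \is a fin_num.
  by rewrite ge0_fin_numE// ltey.
have cI : (fun n => (`|sint mu D (s n)|)%:E) @ \oo --> (`|I|)%:E.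
  by apply/fine_cvgP; split; [exact: nearW|exact: cvg_norm ssI].
have cf : (fun n => \int[mu]_(t in D) (`|f t|)%:E +
    \int[mu]_(t in D) (`|f t - s n t|)%:E)%E @ \oo -->
    (\int[mu]_(t in D) (`|f t|)%:E)%E.
  rewrite -[X in _ --> X]adde0; apply: cvgeD => //; last exact: cvg_cst.
  by rewrite -ffE.
apply: (lee_cvg_to cI cf).
apply: nearW => n; apply: (le_trans (sint_norm mD Dfin (ss n))).
rewrite -ge0_integralD//; last 2 first.
- exact: measurable_norm.
- by apply: measurable_norm; apply: simple_limitB => //;
  exact: simple_simple_limit.
apply: ge0_ae_le_integral_nonmeas => //.
  by move=> t _; rewrite -EFinD lee_fin addr_ge0.
by apply: aeW => t _; rewrite -EFinD lee_fin -{1}(subKr (f t) (s n t))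
  ler_normB.
Qed.

Lemma limit_bochner_ae_unique (V : normedModType R) (f g : T -> V) I J :
  (\forall t \ae mu, D t -> f t = g t) ->
  limit_bochner D f I -> limit_bochner D g J -> I = J.
Proof.
move=> fg bf bg; have := limit_bochner_norm (limit_bochner_linear (-1) bf bg).
rewrite (ge0_ae_eq_integral_nonmeas (g := cst 0%E))//; last first.
  apply: filterS fg => t fgt Dt.
  by rewrite fgt// scaleN1r addNr normr0.
by rewrite integral0 lee_fin scaleN1r normr_le0 addrC subr_eq0 => /eqP.
Qed.

Lemma is_bochner_integral_unique (V : normedModType R) (f g : T -> V) I J :
  (\forall t \ae mu, D t -> f t = g t) ->
  is_bochner_integral mu D f I -> is_bochner_integral mu D g J -> I = J.
Proof.
move=> fg /is_bochner_integralP[f' ff' bf] /is_bochner_integralP[g' gg' bg].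
apply: limit_bochner_ae_unique bf bg.
apply: filterS3 fg ff' gg' => t fg ff' gg' Dt.
by rewrite -ff'// -gg'// fg.
Qed.

Lemma is_bochner_integral_ae_eq (V : normedModType R) (f g : T -> V) I :
  (\forall t \ae mu, D t -> f t = g t) ->
  is_bochner_integral mu D f I -> is_bochner_integral mu D g I.
Proof.
move=> fg /is_bochner_integralP[f' ff' bf]; apply/is_bochner_integralP.
exists f' => //; apply: filterS2 fg ff' => t fg ff' Dt.
by rewrite -ff'// fg.
Qed.

Lemma is_bochner_integral_linear (V : normedModType R) (a : R) (f g : T -> V)
    I J :
  is_bochner_integral mu D f I -> is_bochner_integral mu D g J ->
  is_bochner_integral mu D (fun t => a *: f t + g t) (a *: I + J).
Proof.
move=> /is_bochner_integralP[f' ff' bf] /is_bochner_integralP[g' gg' bg].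
apply/is_bochner_integralP; exists (fun t => a *: f' t + g' t).
  by apply: filterS2 ff' gg' => t ff' gg' Dt; rewrite ff'// gg'.
exact: limit_bochner_linear.
Qed.

Lemma is_bochner_integral_linear_map (V V' : normedModType R)
    (L : {linear V -> V'}) (f : T -> V) I :
  continuous L -> is_bochner_integral mu D f I ->
  is_bochner_integral mu D (L \o f) (L I).
Proof.
move=> cL /is_bochner_integralP[f' ff' bf].
apply/is_bochner_integralP; exists (L \o f').
  by apply: filterS ff' => t ff' Dt /=; rewrite ff'.
exact: limit_bochner_linear_map.
Qed.

Lemma is_bochner_integral_norm (V : normedModType R) (f : T -> V) I :
  is_bochner_integral mu D f I ->
  ((`|I|)%:E <= \int[mu]_(t in D) (`|f t|)%:E)%E.
Proof.
move=> /is_bochner_integralP[f' ff' bf].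
rewrite (ge0_ae_eq_integral_nonmeas (g := fun t => (`|f' t|)%:E))//.
  exact: limit_bochner_norm.
by apply: filterS ff' => t ff' Dt; rewrite ff'.
Qed.

End finite_domain.

(** Extension by zero brings integrals over adjacent intervals to a common
    domain, where they can be added. *)
Lemma is_bochner_integral_restrict (V : normedModType R) (D E : set T)
    (f : T -> V) I :
  measurable D -> measurable E -> D `<=` E -> (mu E < +oo)%E ->
  is_bochner_integral mu D f I ->
  is_bochner_integral mu E (fun t => if t \in D then f t else 0) I.
Proof.
move=> mD mE DE Efin.
have Dfin : (mu D < +oo)%E.
  by apply: le_lt_trans Efin; apply: le_measure; rewrite ?inE.
move=> /(is_bochner_integralP mD Dfin)[g fg [s [ss sg sI ssI]]].
apply/(is_bochner_integralP mE Efin).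
exists (fun t => if t \in D then g t else 0).
  by apply: filterS fg => t fg _; case: ifPn => // /set_mem /fg.
exists (fun n t => if t \in D then s n t else 0).
have sw n := simple_pair (simple_mem mD) (ss n).
have sr n : simple (fun t => if t \in D then s n t else 0).
  by have := simple_comp (fun c : bool * V => if c.1 then c.2 else 0) (sw n).
split => //.
- by move=> t; case: ifPn => _; [exact: sg|exact: cvg_cst].
- apply: cvg_trans sI; apply: near_eq_cvg; apply: nearW => n.
  rewrite [in RHS]integral_mkcond [in LHS]integral_mkcond/=.
  apply: eq_integral => t _; rewrite !patchE.
  have [/set_mem Dt|Dt] := boolP (t \in D); first by rewrite mem_set//;
    exact: DE.
  by rewrite subrr normr0; case: ifP.
apply: cvg_trans ssI; apply: near_eq_cvg; apply: nearW => n.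
rewrite (sint_comp mD Dfin (fun c => c.2) (sw n) : sint mu D (s n) = _).
rewrite (sint_comp mE Efin (fun c => if c.1 then c.2 else 0) (sw n) :
  sint mu E (fun t => if t \in D then s n t else 0) = _).
apply: eq_fsbigr => -[b v] _ /=; set A := _ @^-1` _.
have AE t : A t -> (t \in D) = b /\ s n t = v by move=> /= [-> ->].
case: b @A AE => A AE.
  congr (fine (mu _) *: _); apply/seteqP; split=> t [Et At]; split => //.
    exact: DE.
  by apply/set_mem; exact: (AE _ At).1.
rewrite scaler0 (_ : D `&` A = set0) ?measure0 ?scale0r//.
apply/seteqP; split => // t [Dt At].
by have [] := AE _ At; rewrite mem_set.
Qed.

Lemma sint_measure_preserving (V : normedModType R) (D : set T) (phi : T -> T)
    (f : T -> V) :
  measurable D -> measurable_fun setT phi ->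
  (forall A, measurable A -> mu (phi @^-1` A) = mu A) ->
  simple f -> sint mu (phi @^-1` D) (f \o phi) = sint mu D f.
Proof.
move=> mD mphi phimu sf.
rewrite (sint_widen _ _ (A := range f)); last by move=> _ [t _ <-];
  exists (phi t).
apply: eq_fsbigr => v _; congr (fine _ *: _).
rewrite -[RHS]phimu//; by apply: measurableI => //; exact: sf.2.
Qed.

(** The fibres of [s \o phi] are the preimages of those of [s], so integrals of
    simple functions are preserved, and limits follow. *)
Lemma is_bochner_integral_measure_preserving (V : normedModType R) (D : set T)
    (phi : T -> T) (f : T -> V) I :
  measurable D -> (mu D < +oo)%E -> measurable_fun setT phi ->
  (forall A, measurable A -> mu (phi @^-1` A) = mu A) ->
  is_bochner_integral mu D f I ->
  is_bochner_integral mu (phi @^-1` D) (f \o phi) I.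
Proof.
move=> mD Dfin mphi phimu /(is_bochner_integralP mD Dfin)[g [N [mN N0 sN]] [s
  [ss sg sI ssI]]].
have mpD : measurable (phi @^-1` D) by rewrite -[X in measurable X]setTI;
  exact: mphi.
apply/is_bochner_integralP; [exact: mpD|by rewrite phimu|].
have lg : simple_limit g by exists s.
exists (g \o phi).
  exists (phi @^-1` N); split.
  - by rewrite -[X in measurable X]setTI; exact: mphi.
  - by rewrite phimu.
  - by move=> t /= H; apply: sN => /= H'; apply: H => /H'.
exists (fun n => s n \o phi); split.
- by move=> n; exact: simple_comp_measurable.
- by move=> t; exact: sg.
- apply: cvg_trans sI; apply: near_eq_cvg; apply: nearW => n.
  have mgs : measurable_fun setT (fun t => (`|g t - s n t|)%:E).
    apply/measurable_EFinP; apply: simple_limit_measurable_norm.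
    by apply: simple_limitB => //; exact: simple_simple_limit.
  rewrite [LHS](eq_measure_integral (pushforward mu phi)).
    rewrite ge0_integral_pushforward//; exact: measurable_funTS.
  by move=> A mA _; exact/esym/phimu.
apply: cvg_trans ssI; apply: near_eq_cvg; apply: nearW => n.
by rewrite sint_measure_preserving.
Qed.

End bochner_integral.

(** * Lebesgue measure: translations and restriction to the half-line *)

Section lebesgue.
Context {R : realType}.
Local Notation leb := (@lebesgue_measure R).
Local Notation halfline := (@lebesgue_nonneg R).

Lemma measurable_translation (tau : R) :
  measurable_fun setT (fun t : measurableTypeR R => (t + tau : measurableTypeR
    R)).
Proof. by apply: measurable_funD. Qed.

(** Translations permute the half-open intervals and preserve their lengths,
    which determine the measure. *)
Lemma lebesgue_measure_translation (tau : R) (A : set (measurableTypeR R)) :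
  measurable A -> leb ((fun t => t + tau) @^-1` A) = leb A.
Proof.
pose phi (t : measurableTypeR R) : measurableTypeR R := t + tau.
have mphi : measurable_fun setT phi by exact: measurable_translation.
move=> mA; apply/esym.
rewrite (@lebesgue_measure_unique R (pushforward leb phi))//.
move=> _ [[a b]] _ <-.
transitivity (leb `]a - tau, b - tau]%classic).
  by rewrite !lebesgue_measure_itv/= !lte_fin ltrD2r -!EFinB opprB addrA subrK.
congr (leb _).
by apply/seteqP; split=> t; rewrite /= !in_itv/= /phi ltrBlDr lerBrDr.
Qed.

Lemma ae_lebesgue_nonneg (P : R -> Prop) :
  (\forall t \ae halfline, P t) <-> (\forall t \ae leb, 0 <= t -> P t).
Proof.
split=> [[N [mN N0 sN]]|[N [mN N0 sN]]].
  exists (N `&` nonnegatives); split => //.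
    by apply: measurableI => //; exact: measurable_nonnegatives.
  move=> t /= H; split; last by apply: contrapT => t0; apply: H => /t0.
  by apply: sN => /= Pt; apply: H.
exists (N `|` ~` nonnegatives); split.
- by apply: measurableU => //; apply: measurableC;
  exact: measurable_nonnegatives.
- rewrite /= /mrestr setIUl setICl setU0.
  apply: (@subset_measure0 _ _ _ leb _ N) => //.
  by apply: measurableI => //; exact: measurable_nonnegatives.
move=> t /= nP; have [t0|] := pselect (nonnegatives t); last by right.
by left; apply: sN => /= /(_ t0).
Qed.

Lemma ae_lebesgue_nonneg_ge0 : \forall t \ae halfline, 0 <= t.
Proof. by apply/ae_lebesgue_nonneg; apply: aeW. Qed.

Lemma ae_lebesgue_shift (tau : R) (P : R -> Prop) :
  (\forall t \ae leb, P t) -> \forall t \ae leb, P (t + tau).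
Proof.
move=> [N [mN N0 sN]]; exists ((fun t => t + tau) @^-1` N); split.
- rewrite -[X in measurable X]setTI.
  by apply: measurable_translation.
- exact: etrans (lebesgue_measure_translation _ mN) N0.
- by move=> t /= H; exact: sN.
Qed.

Lemma integral_lebesgue_nonneg (D : set (measurableTypeR R))
    (f : R -> \bar R) :
  D `<=` nonnegatives ->
  (\int[halfline]_(t in D) f t = \int[leb]_(t in D) f t)%E.
Proof.
move=> D0; apply: eq_measure_integral => A mA AD.
by rewrite /= /mrestr setIidl//; exact: subset_trans D0.
Qed.

Lemma integral_lebesgue_nonnegT (f : R -> \bar R) : (forall t, 0 <= f t)%E ->
  (\int[halfline]_t f t = \int[leb]_(t in nonnegatives) f t)%E.
Proof.
move=> f0; rewrite -integral_lebesgue_nonneg// [RHS]integral_mkcond.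
apply: ge0_ae_eq_integral_nonmeas => //.
  by move=> t _; rewrite patchE; case: ifP.
have F := ae_filter_ringOfSetsType halfline.
apply: filterS ae_lebesgue_nonneg_ge0 => t t0 _.
by rewrite patchE mem_set.
Qed.

Lemma ge0_integral_shift (tau : R) (f : R -> \bar R) :
  0 <= tau -> measurable_fun (setT : set (measurableTypeR R)) f ->
  (forall t, 0 <= f t)%E ->
  (\int[halfline]_t f (t + tau)%R <= \int[halfline]_t f t)%E.
Proof.
move=> tau0 mf f0; rewrite !integral_lebesgue_nonnegT//.
pose phi (t : measurableTypeR R) : measurableTypeR R := t + tau.
have mphi : measurable_fun setT phi by exact: measurable_translation.
pose D : set (measurableTypeR R) := `[tau, +oo[%classic.
have mD : measurable D by exact: measurable_itv.
have E : nonnegatives = phi @^-1` D.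
  by apply/seteqP; split=> t; rewrite /D /phi /= in_itv/= andbT lerDr.
rewrite [in leLHS]E; have := ge0_integral_pushforward mphi leb mD
  (measurable_funTS mf) (fun y _ => f0 y).
rewrite /comp => <-.
rewrite [leLHS](eq_measure_integral leb); last first.
  move=> A mA _; exact: (lebesgue_measure_translation tau mA).
apply: ge0_subset_integral; [exact: mD|exact: (@measurable_nonnegatives R)|..]
  => //.
- exact: measurable_funTS.
- by move=> t; rewrite /D /= in_itv/= andbT; exact: le_trans.
Qed.

End lebesgue.

(** * The L^p norm of functions with values in a normed space *)

Section Lp_norms.
Context {d : measure_display} {T : measurableType d} {R : realType}.
Variable mu : {measure set T -> \bar R}.
Local Notation Np p f := ('N[mu]_p[(fun t => (`|f t|)%:E)])%E.

(** Monotonicity for norms that may fail to be measurable; it is what allows a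
    function to be replaced by an almost everywhere equal one. *)
Lemma Lnorm_norm_ae_le (V V' : normedModType R) p (f : T -> V) (g : T -> V') :
  (1 <= p)%E -> (\forall t \ae mu, `|f t| <= `|g t|) -> (Np p f <= Np p g)%E.
Proof.
rewrite unlock; case: p => [r| |//] p1 fg; last first.
  case: ifP => // _; apply: le_ess_sup; apply: filterS fg => t fg.
  by rewrite /= lee_fin !normr_id.
have r0 : 0 <= r by rewrite (le_trans ler01).
have fin_pos (x : \bar R) : (0 <= x)%E -> x \in `[0%E, +oo%E].
  by move=> x0; rewrite in_itv/= x0 leey.
apply: gt0_ler_poweR; rewrite ?invr_ge0//.
- by apply: fin_pos; apply: integral_ge0 => t _; exact: poweR_ge0.
- by apply: fin_pos; apply: integral_ge0 => t _; exact: poweR_ge0.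
apply: ge0_ae_le_integral_nonmeas.
- by move=> t _; exact: poweR_ge0.
- by move=> t _; exact: poweR_ge0.
apply: filterS fg => t fg _; apply: gt0_ler_poweR => //; try exact: fin_pos.
by rewrite lee_fin !normr_id.
Qed.

Lemma Lnorm_norm_ae_eq (V V' : normedModType R) p (f : T -> V) (g : T -> V') :
  (1 <= p)%E -> (\forall t \ae mu, `|f t| = `|g t|) -> Np p f = Np p g.
Proof.
move=> p1 fg; apply/eqP; rewrite eq_le !Lnorm_norm_ae_le//.
  by apply: filterS fg => t ->.
by apply: filterS fg => t ->.
Qed.

Lemma Lnorm_norm_triangle (V : normedModType R) p (f g : T -> V) :
  (1 <= p)%E -> strongly_measurable mu f -> strongly_measurable mu g ->
  (Np p (fun t => f t + g t) <= Np p f + Np p g)%E.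
Proof.
move=> p1 /strongly_measurableP[f' sf ff'] /strongly_measurableP[g' sg gg'].
rewrite (Lnorm_norm_ae_eq (g := fun t => `|f' t|) (f := f) p1); last first.
  by apply: filterS ff' => t ->; rewrite normr_id.
rewrite (Lnorm_norm_ae_eq (g := fun t => `|g' t|) (f := g) p1); last first.
  by apply: filterS gg' => t ->; rewrite normr_id.
apply: le_trans.
  apply: (Lnorm_norm_ae_le (g := fun t => `|f' t| + `|g' t|) p1).
  apply: filterS2 ff' gg' => t -> ->.
  by rewrite [leRHS]ger0_norm ?addr_ge0// ler_normD.
have E (h : T -> R) : Np p h = 'N[mu]_p[EFin \o h]%E.
  by rewrite -[RHS]Lnorm_abse.
by rewrite !E; apply: eminkowski => //; exact: simple_limit_measurable_norm.
Qed.

Lemma Lnorm_norm_scale (V : normedModType R) p (a : R) (f : T -> V) :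
  (1 <= p)%E -> strongly_measurable mu f ->
  Np p (fun t => a *: f t) = (`|a|%:E * Np p f)%E.
Proof.
move=> p1 /strongly_measurableP[f' sf ff'].
rewrite (Lnorm_norm_ae_eq (g := f') (f := f) p1);
  last by apply: filterS ff' => t ->.
rewrite (Lnorm_norm_ae_eq (g := fun t => a *: f' t) (f := fun t => a *: f t)
  p1); last by apply: filterS ff' => t ->.
rewrite unlock; case: p p1 => [r| |//] p1; last first.
  case: ifP => [mu0|]; last by rewrite mule0.
  rewrite -ess_supZl//; congr ess_sup; apply/funext => t /=.
  by rewrite normrZ !normrM !normr_id.
have r1 : 1 <= r by rewrite -lee_fin.
have r0 : 0 < r by exact: lt_le_trans r1.
have mf : measurable_fun setT (fun t => (`|(`|f' t|)%:E| `^ r)%E).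
  apply: (measurableT_comp (measurable_poweR r)); apply/measurable_EFinP.
  apply: measurableT_comp => //.
  exact: simple_limit_measurable_norm.
under eq_integral do rewrite normrZ EFinM abseM poweRM//.
rewrite ge0_integralZl//; [|by move=> t _; exact: poweR_ge0|exact: poweR_ge0].
rewrite poweRM; first by rewrite -poweRrM divff ?gt_eqF// poweRe1 /=
  ?normr_id// lee_fin.
  exact: poweR_ge0.
by apply: integral_ge0 => t _; exact: poweR_ge0.
Qed.

Lemma Lnorm_norm_eq0 (V : normedModType R) p (f : T -> V) :
  (1 <= p)%E -> strongly_measurable mu f ->
  Np p f = 0%E <-> \forall t \ae mu, f t = 0.
Proof.
move=> p1 /strongly_measurableP[f' sf ff'].
have p0 : (0 < p)%E by apply: lt_le_trans p1; rewrite lte_fin.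
rewrite (Lnorm_norm_ae_eq (g := f') (f := f) p1);
  last by apply: filterS ff' => t ->.
split=> [f0|f0].
  have mf : measurable_fun setT (fun t => (`|f' t|)%:E).
    by apply/measurable_EFinP; exact: simple_limit_measurable_norm.
  apply: filterS2 ff' (Lnorm_eq0_eq0 mf p0 f0) => t -> /(_ Logic.I) /= [].
  by move=> /eqP; rewrite normr_eq0 => /eqP.
rewrite (Lnorm_norm_ae_eq (g := fun=> (0 : R)) (f := f') p1); last first.
  by apply: filterS2 ff' f0 => t <- ->; rewrite !normr0.
rewrite (_ : (fun t => _) = cst 0%E); first by rewrite Lnorm0// gt_eqF.
by apply/funext => t; rewrite normr0.
Qed.

End Lp_norms.

(** * The input space L^p of the half-line *)

Section Lp_inputs_theory.
Context {R : realType} {U : normedModType R}.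
Variable p : \bar R.
Hypothesis p1 : (1 <= p)%E.
Local Notation leb := (@lebesgue_measure R).
Local Notation halfline := (@lebesgue_nonneg R).
Implicit Types (u v : R -> U) (tau : R).

#[local] Instance ae_halfline_filter : Filter (almost_everywhere halfline) :=
  ae_filter_ringOfSetsType halfline.

#[local] Instance ae_lebesgue_filter : Filter (almost_everywhere leb) :=
  ae_filter_ringOfSetsType leb.

Lemma Lp_enorm_ge0 u : (0 <= Lp_enorm p u)%E.
Proof. exact: Lnorm_ge0. Qed.

Lemma Lp_normE u : Lp_inputs p u -> Lp_enorm p u = (Lp_norm p u)%:E.
Proof. by move=> [_ fu]; rewrite fineK// ge0_fin_numE// Lp_enorm_ge0. Qed.

Lemma Lp_norm_ge0 u : 0 <= Lp_norm p u.
Proof. by rewrite fine_ge0// Lp_enorm_ge0. Qed.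

Lemma Lp_enorm_le_norm u c : Lp_inputs p u ->
  (Lp_enorm p u <= c%:E)%E = (Lp_norm p u <= c).
Proof. by move=> /Lp_normE ->; rewrite lee_fin. Qed.

Lemma strongly_measurable_linear (a : R) u v :
  strongly_measurable halfline u -> strongly_measurable halfline v ->
  strongly_measurable halfline (fun t => a *: u t + v t).
Proof.
move=> /strongly_measurableP[u' su uu'] /strongly_measurableP[v' sv vv'].
apply/strongly_measurableP; exists (fun t => a *: u' t + v' t).
  exact: simple_limit_linear.
by apply: filterS2 uu' vv' => t -> ->.
Qed.

Lemma strongly_measurable_scale (a : R) u :
  strongly_measurable halfline u ->
  strongly_measurable halfline (fun t => a *: u t).
Proof.
move=> /strongly_measurableP[u' su uu'].
apply/strongly_measurableP; exists (fun t => a *: u' t).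
  exact: simple_limitZ.
by apply: filterS uu' => t ->.
Qed.

Lemma Lp_inputs_linear : is_linear_function_space (@Lp_inputs R U p).
Proof.
have s0 : strongly_measurable halfline (fun=> 0 : U).
  apply/strongly_measurableP; exists (fun=> 0); last exact: aeW.
  by apply: simple_simple_limit; exact: simple_cst.
split=> [|a u v [su fu] [sv fv]]; split => //.
- have -> : Lp_enorm p (fun=> 0 : U) = 0%E.
    by apply/(Lnorm_norm_eq0 p1 s0); exact: aeW.
  by rewrite lt0y.
- exact: strongly_measurable_linear.
apply: (le_lt_trans (Lnorm_norm_triangle p1 (strongly_measurable_scale a su)
  sv)).
rewrite Lnorm_norm_scale// lte_add_pinfty//.
by rewrite lte_mul_pinfty// lee_fin.
Qed.

Lemma Lp_inputs_lin (a : R) u v :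
  Lp_inputs p u -> Lp_inputs p v -> Lp_inputs p (fun t => a *: u t + v t).
Proof. exact: Lp_inputs_linear.2. Qed.

Lemma Lp_inputsZ (a : R) u : Lp_inputs p u -> Lp_inputs p (a *: u).
Proof.
move=> Lu; have := Lp_inputs_lin a Lu Lp_inputs_linear.1.
by congr Lp_inputs; apply/funext => t; rewrite addr0.
Qed.

Lemma Lp_inputsD u v : Lp_inputs p u -> Lp_inputs p v -> Lp_inputs p (u + v).
Proof.
move=> Lu Lv; have := Lp_inputs_lin 1 Lu Lv.
by congr Lp_inputs; apply/funext => t; rewrite scale1r.
Qed.

Lemma Lp_inputsB u v : Lp_inputs p u -> Lp_inputs p v -> Lp_inputs p (u - v).
Proof.
by move=> Lu Lv; apply: Lp_inputsD => //; rewrite -scaleN1r; exact: Lp_inputsZ.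
Qed.

Lemma Lp_norm_seminorm : seminorm_on (@Lp_inputs R U p) (Lp_norm p).
Proof.
split=> [u v Lu Lv|a u Lu].
  rewrite -lee_fin EFinD -!Lp_normE//; last exact: Lp_inputsD.
  exact: (Lnorm_norm_triangle p1 Lu.1 Lv.1).
apply: EFin_inj; rewrite EFinM -!Lp_normE//; last exact: Lp_inputsZ.
exact: (Lnorm_norm_scale _ p1 Lu.1).
Qed.

Lemma eq_upto_halfline u v :
  eq_upto (almost_everywhere halfline) nonnegatives u v <->
  \forall t \ae halfline, u t = v t.
Proof.
split=> uv; last by apply: filterS uv.
by apply: filterS2 uv ae_lebesgue_nonneg_ge0 => t /[apply].
Qed.

Lemma Lp_norm_is_norm :
  is_norm_upto (almost_everywhere halfline) (@Lp_inputs R U p) (Lp_norm p).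
Proof.
split; [exact: Lp_norm_seminorm.1|exact: Lp_norm_seminorm.2|].
move=> u Lu; rewrite eq_upto_halfline -(Lnorm_norm_eq0 p1 Lu.1).
rewrite -/(Lp_enorm p u) Lp_normE//.
by split=> [->|[]].
Qed.

Lemma Lp_inputs_saturated u v :
  Lp_inputs p u -> (\forall t \ae halfline, u t = v t) -> Lp_inputs p v.
Proof.
move=> [/strongly_measurableP[u' su uu'] fu] uv; split.
  apply/strongly_measurableP; exists u' => //.
  by apply: filterS2 uv uu' => t <-.
apply: le_lt_trans fu; apply: Lnorm_norm_ae_le => //.
by apply: filterS uv => t ->.
Qed.

Lemma Lp_inputs_dominated u v : Lp_inputs p v ->
  strongly_measurable halfline u ->
  (\forall t \ae halfline, `|u t| <= `|v t|) -> Lp_inputs p u.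
Proof.
move=> [sv fv] su uv; split => //.
by apply: le_lt_trans fv; exact: Lnorm_norm_ae_le.
Qed.

Lemma Lp_norm_ae_le u v : Lp_inputs p u -> Lp_inputs p v ->
  (\forall t \ae halfline, `|u t| <= `|v t|) -> Lp_norm p u <= Lp_norm p v.
Proof.
by move=> Lu Lv uv; rewrite -lee_fin -!Lp_normE//; exact: Lnorm_norm_ae_le.
Qed.

Lemma ae_halfline_shift tau (P : R -> Prop) : 0 <= tau ->
  (\forall t \ae halfline, P t) -> \forall t \ae halfline, P (t + tau).
Proof.
move=> tau0 /ae_lebesgue_nonneg /(ae_lebesgue_shift tau) h.
apply/ae_lebesgue_nonneg; apply: filterS h => t h t0.
by apply: h; rewrite addr_ge0.
Qed.

Lemma ae_halfline_delay tau (P : R -> Prop) :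
  (\forall t \ae halfline, P t) ->
  \forall t \ae halfline, tau <= t -> P (t - tau).
Proof.
move=> /ae_lebesgue_nonneg /(ae_lebesgue_shift (- tau)) h.
apply/ae_lebesgue_nonneg; apply: filterS h => t h _ taut.
by apply: h; rewrite subr_ge0.
Qed.

(* The p-th powers are compared by integration, the essential suprema
   directly. *)
Let Lp_enorm_le_powers u v : simple_limit u -> simple_limit v ->
  (forall h : R -> \bar R, (forall x : R, 0 <= h x)%E ->
    measurable_fun setT h -> h 0 = 0%E ->
    (\int[halfline]_t h `|u t|%R <= \int[halfline]_t h `|v t|%R)%E) ->
  (forall c : \bar R, (\forall t \ae halfline, (`|v t|)%:E <= c)%E ->
    \forall t \ae halfline, (`|u t|)%:E <= c)%E ->
  (Lp_enorm p u <= Lp_enorm p v)%E.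
Proof.
move=> su sv hint hess; rewrite /Lp_enorm unlock.
case: p p1 => [r| |//] r1; last first.
  case: ifP => // _; apply/ess_supP => /=.
  have /hess : \forall t \ae halfline,
      ((`|v t|)%:E <= ess_sup halfline (abse \o (fun t => (`|v t|)%:E)))%E.
    apply: filterS (ess_sup_ge halfline (abse \o (fun t => (`|v t|)%:E))) => t
      /=.
    by rewrite normr_id.
  by apply: filterS => t; rewrite normr_id.
have r0 : 0 < r by rewrite -lte_fin (lt_le_trans _ r1)// lte_fin.
have pos (x : \bar R) : (0 <= x)%E -> x \in `[0%E, +oo%E].
  by move=> x0; rewrite in_itv/= x0 leey.
apply: gt0_ler_poweR; rewrite ?invr_ge0 ?(ltW r0)//.
- by apply: pos; apply: integral_ge0 => t _; exact: poweR_ge0.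
- by apply: pos; apply: integral_ge0 => t _; exact: poweR_ge0.
apply: (hint (fun x => `|x%:E| `^ r)%E).
- by move=> x; exact: poweR_ge0.
- apply: (measurableT_comp (measurable_poweR r)); exact/measurable_EFinP.
- by rewrite abse0 poweR0r// gt_eqF.
Qed.

Lemma Lp_enorm_shift tau u : 0 <= tau -> strongly_measurable halfline u ->
  (Lp_enorm p (shift_input tau u) <= Lp_enorm p u)%E.
Proof.
move=> tau0 /strongly_measurableP[u' su uu'].
have -> : Lp_enorm p u = Lp_enorm p u'.
  by apply: Lnorm_norm_ae_eq => //; apply: filterS uu' => t ->.
have -> : Lp_enorm p (shift_input tau u) = Lp_enorm p (shift_input tau u').
  apply: Lnorm_norm_ae_eq => //; apply: filterS (ae_halfline_shift tau0 uu') =>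
    t.
  by rewrite /shift_input => ->.
apply: Lp_enorm_le_powers => //.
- exact: (simple_limit_comp_measurable (measurable_translation tau) su).
- move=> h h0 mh _; apply: (ge0_integral_shift (f := fun t => h `|u' t|)) => //.
  by apply: measurableT_comp => //; exact: simple_limit_measurable_norm.
- by move=> c; exact: ae_halfline_shift.
Qed.

Lemma Lp_inputs_shift tau u : 0 <= tau -> Lp_inputs p u ->
  Lp_inputs p (shift_input tau u).
Proof.
move=> tau0 [su fu]; split; last exact: le_lt_trans (Lp_enorm_shift _ su) fu.
have /strongly_measurableP[u' su' uu'] := su.
apply/strongly_measurableP; exists (u' \o (fun t => t + tau)).
  exact: (simple_limit_comp_measurable (measurable_translation tau) su').
exact: (ae_halfline_shift tau0 uu').
Qed.

Lemma Lp_norm_shift tau u : 0 <= tau -> Lp_inputs p u ->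
  Lp_norm p (shift_input tau u) <= Lp_norm p u.
Proof.
move=> tau0 Lu; rewrite -lee_fin -!Lp_normE//; last exact: Lp_inputs_shift.
exact: Lp_enorm_shift Lu.1.
Qed.

Definition delay_input tau u : R -> U := concat_input (fun=> 0) tau u.

Let measurable_lt tau : measurable ([set t | t < tau] : set (measurableTypeR
  R)).
Proof.
rewrite (_ : [set t | _] = `]-oo, tau[%classic); first exact: measurable_itv.
by apply/seteqP; split=> t; rewrite /= in_itv.
Qed.

Lemma simple_limit_concat tau u v : simple_limit u -> simple_limit v ->
  simple_limit (concat_input u tau v : measurableTypeR R -> U).
Proof.
move=> su sv.
have := simple_limit_if (measurable_lt tau) su
  (simple_limit_comp_measurable (measurable_translation (- tau)) sv).
congr simple_limit; apply/funext => t; rewrite /concat_input.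
have [tt|tt] := ltP t tau; first by rewrite mem_set.
by rewrite memNset//=; apply/negP; rewrite -leNgt.
Qed.

Lemma strongly_measurable_concat tau u v :
  strongly_measurable halfline u -> strongly_measurable halfline v ->
  strongly_measurable halfline (concat_input u tau v).
Proof.
move=> /strongly_measurableP[u' su uu'] /strongly_measurableP[v' sv vv'].
apply/strongly_measurableP; exists (concat_input u' tau v').
  exact: simple_limit_concat.
apply: filterS2 uu' (ae_halfline_delay tau vv') => t ut vt.
by rewrite /concat_input; case: ltP => // /vt.
Qed.

Lemma Lp_enorm_delay tau u : 0 <= tau -> strongly_measurable halfline u ->
  (Lp_enorm p (delay_input tau u) <= Lp_enorm p u)%E.
Proof.
move=> tau0 /strongly_measurableP[u' su uu'].
have -> : Lp_enorm p u = Lp_enorm p u'.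
  by apply: Lnorm_norm_ae_eq => //; apply: filterS uu' => t ->.
have -> : Lp_enorm p (delay_input tau u) = Lp_enorm p (delay_input tau u').
  apply: Lnorm_norm_ae_eq => //; apply: filterS (ae_halfline_delay tau uu') =>
    t.
  by rewrite /delay_input /concat_input; case: ltP => // _ ->.
have s0 : simple_limit (fun _ : measurableTypeR R => 0 : U).
  by apply: simple_simple_limit; exact: simple_cst.
apply: Lp_enorm_le_powers => //; first exact: simple_limit_concat.
- move=> h h0 mh hz.
  have mhu : measurable_fun setT (fun t : measurableTypeR R => h `|u' t|).
    by apply: measurableT_comp => //; exact: simple_limit_measurable_norm.
  rewrite !integral_lebesgue_nonnegT//.
  pose phi (t : measurableTypeR R) : measurableTypeR R := t - tau.
  have mphi : measurable_fun setT phi by exact: measurable_translation.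
  have mD := @measurable_nonnegatives R.
  have := ge0_integral_pushforward mphi leb mD (measurable_funTS mhu)
    (fun y _ => h0 `|u' y|).
  rewrite [LHS](eq_measure_integral leb); last first.
    move=> A mA _; exact: (lebesgue_measure_translation (- tau) mA).
  move=> ->; rewrite [leRHS]integral_mkcond [leLHS]integral_mkcond.
  apply: ge0_ae_le_integral_nonmeas.
  + by move=> t _; rewrite patchE; case: ifP.
  + by move=> t _; rewrite patchE; case: ifP => // _; exact: h0.
  apply: aeW => t _; rewrite !patchE /delay_input /concat_input.
  case: ltP => tt.
    by rewrite normr0 hz if_same; case: ifP => // _; exact: h0.
  have t0 : nonnegatives t by exact: le_trans tau0 tt.
  have pt : (phi @^-1` nonnegatives) t by rewrite /nonnegatives/= /phi subr_ge0.
  by rewrite !mem_set.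
move=> c uc; apply: filterS2 uc (ae_halfline_delay tau uc) => t ut udt.
rewrite /delay_input /concat_input; case: ltP => [_|/udt//].
by rewrite normr0; apply: le_trans ut; rewrite lee_fin.
Qed.

Lemma Lp_inputs_delay tau u : 0 <= tau -> Lp_inputs p u ->
  Lp_inputs p (delay_input tau u).
Proof.
move=> tau0 [su fu]; split; last exact: le_lt_trans (Lp_enorm_delay _ su) fu.
by apply: strongly_measurable_concat => //; exact: Lp_inputs_linear.1.1.
Qed.

Lemma Lp_norm_delay tau u : 0 <= tau -> Lp_inputs p u ->
  Lp_norm p (delay_input tau u) <= Lp_norm p u.
Proof.
move=> tau0 Lu; rewrite -lee_fin -!Lp_normE//; last exact: Lp_inputs_delay.
exact: Lp_enorm_delay Lu.1.
Qed.

Definition cut_input (A : set R) u : R -> U := fun t => if t \in A then u t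
  else 0.

Lemma Lp_inputs_cut (A : set (measurableTypeR R)) u :
  measurable A -> Lp_inputs p u -> Lp_inputs p (cut_input A u).
Proof.
move=> mA Lu; apply: (Lp_inputs_dominated Lu).
  have /strongly_measurableP[u' su uu'] := Lu.1.
  apply/strongly_measurableP; exists (cut_input A u').
    apply: simple_limit_if => //.
    by apply: simple_simple_limit; exact: simple_cst.
  by apply: filterS uu' => t ut; rewrite /cut_input ut.
by apply: aeW => t; rewrite /cut_input; case: ifP => // _; rewrite normr0.
Qed.

(** A concatenation is the sum of a truncated input and of a delayed one. *)
Lemma Lp_inputs_concat tau u v : 0 <= tau ->
  Lp_inputs p u -> Lp_inputs p v -> Lp_inputs p (concat_input u tau v).
Proof.
move=> tau0 Lu Lv.
have := Lp_inputsD (Lp_inputs_cut (measurable_lt tau) Lu) (Lp_inputs_delay tau0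
  Lv).
congr Lp_inputs; apply/funext => t.
transitivity (cut_input [set t | t < tau] u t + delay_input tau v t) => //.
rewrite /cut_input /delay_input /concat_input.
have [tt|tt] := ltP t tau; first by rewrite mem_set// addr0.
by rewrite memNset ?add0r//=; apply/negP; rewrite -leNgt.
Qed.

End Lp_inputs_theory.

(** * Finite exponents *)

Lemma cvg_powR (R : realType) (r : R) (x : nat -> R) (l : R) :
  1 <= r -> (forall n, 0 <= x n) -> x n @[n --> \oo] --> l ->
  x n `^ r @[n --> \oo] --> l `^ r.
Proof.
move=> r1 x0 xl; have r0 : 0 < r by exact: lt_le_trans r1.
have l0 : 0 <= l.
  by apply: (cvgr_to_ge xl); apply: nearW => n; exact: x0.
(* At [0], where [ln] is not continuous, [x n `^ r <= x n] eventually. *)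
have [l_eq0|l_neq0] := eqVneq l 0.
  rewrite l_eq0 powR0 ?gt_eqF//; rewrite l_eq0 in xl.
  apply: (@squeeze_cvgr _ _ _ _ (cst 0) x) => //; last exact: cvg_cst.
  apply: filterS (cvgr_lt _ xl _ ltr01) => n xn.
  rewrite powR_ge0/=; have := x0 n; rewrite le_eqVlt => /predU1P[<-|xn0].
    by rewrite powR0// gt_eqF.
  by apply: ge1r_powR => //; rewrite xn0 ltW.
have {l_neq0}l0 : 0 < l by rewrite lt_neqAle eq_sym l_neq0.
rewrite [X in _ --> X]/powR gt_eqF//.
apply: (@cvg_trans _ (expR (r * ln (x n)) @[n --> \oo])).
  apply: near_eq_cvg; near=> n.
  by rewrite /powR gt_eqF//; near: n; exact: cvgr_gt xl _ l0.
apply: continuous_cvg; first exact: continuous_expR.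
apply: cvgMr; apply: continuous_cvg => //; exact: continuous_ln.
Unshelve. all: by end_near. Qed.

Section finite_exponent.
Context {R : realType} {U : completeNormedModType R}.
Variable r : R.
Hypothesis r1 : 1 <= r.
Local Notation leb := (@lebesgue_measure R).
Local Notation halfline := (@lebesgue_nonneg R).
Local Notation p := (r%:E).
Implicit Types (u v : R -> U).

#[local] Existing Instance ae_halfline_filter.
#[local] Existing Instance ae_lebesgue_filter.

Let r0 : 0 < r. Proof. exact: lt_le_trans r1. Qed.

Let p1 : (1 <= p)%E. Proof. by rewrite lee_fin. Qed.

Lemma Lp_enorm_leP u c : 0 <= c ->
  (Lp_enorm p u <= c%:E)%E <->
  (\int[halfline]_t (`|u t| `^ r)%:E <= (c `^ r)%:E)%E.
Proof.
move=> c0; rewrite /Lp_enorm unlock.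
under eq_integral do rewrite /= normr_id.
set x := (\int[_]_t _)%E.
have x0 : (0 <= x)%E by apply: integral_ge0 => t _; rewrite lee_fin powR_ge0.
have pos (y : \bar R) : (0 <= y)%E -> y \in `[0%E, +oo%E].
  by move=> y0; rewrite in_itv/= y0 leey.
have xr : ((x `^ r^-1) `^ r = x)%E.
  by rewrite -poweRrM mulVf ?gt_eqF// poweRe1.
have cr : (((c `^ r)%:E) `^ r^-1 = c%:E)%E.
  by rewrite poweR_EFin -powRrM divff ?gt_eqF// powRr1.
split=> [xc|xc].
  rewrite -xr -poweR_EFin; apply: gt0_ler_poweR => //; first exact: ltW.
  - by apply: pos; exact: poweR_ge0.
  - by apply: pos; rewrite lee_fin.
rewrite -cr; apply: gt0_ler_poweR => //; first by rewrite invr_ge0 ltW.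
- exact: pos.
- by apply: pos; rewrite lee_fin powR_ge0.
Qed.

Let measurable_norm_powR u : simple_limit u ->
  measurable_fun setT (fun t : measurableTypeR R => (`|u t| `^ r)%:E).
Proof.
move=> su; apply/measurable_EFinP.
apply: (measurableT_comp (measurable_powR r)).
exact: simple_limit_measurable_norm.
Qed.

Let integrable_norm_powR u : simple_limit u -> Lp_inputs p u ->
  halfline.-integrable setT (EFin \o (fun t => `|u t| `^ r)).
Proof.
move=> su Lu; apply/integrableP; split; first exact: measurable_norm_powR.
under eq_integral do rewrite /= (ger0_norm (powR_ge0 _ _)).
apply: (@le_lt_trans _ _ ((Lp_norm p u) `^ r)%:E); last exact: ltry.
by apply/Lp_enorm_leP; [exact: Lp_norm_ge0|rewrite Lp_normE].
Qed.

(** Functions in L^p are locally integrable, since [x <= 1 + x `^ r]; the bound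
    is obtained for norms at most [1] and scaled. *)
Lemma integral_norm_le_Lp_norm u (c t : R) : 0 < c -> 0 <= t ->
  Lp_inputs p u -> Lp_norm p u <= c ->
  (\int[leb]_(s in `[0%R, t]) (`|u s|)%:E <= (c * (t + 1))%R%:E)%E.
Proof.
move=> c0 t0 Lu uc.
have /strongly_measurableP[u' su uu'] := Lu.1.
have Dpos : `[0, t]%classic `<=` @nonnegatives R.
  by move=> s; rewrite /= in_itv/= => /andP[].
have mD : measurable (`[0, t]%classic : set (measurableTypeR R)).
  exact: measurable_itv.
rewrite -(integral_lebesgue_nonneg _ Dpos).
rewrite (ge0_ae_eq_integral_nonmeas (g := fun s => (c * `|c^-1 *: u'
  s|)%:E))//; last 2 first.
- by move=> s _; rewrite lee_fin mulr_ge0// ltW.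
- apply: filterS uu' => s -> _; congr EFin.
  by rewrite normrZ gtr0_norm ?invr_gt0// mulVKf// gt_eqF.
pose w s := c^-1 *: u' s.
have sw : simple_limit (w : measurableTypeR R -> U) by exact: simple_limitZ.
have Nw : (\int[halfline]_s (`|w s| `^ r)%:E <= 1)%E.
  have -> : 1%E = (1 `^ r)%:E by rewrite powR1.
  apply/Lp_enorm_leP => //.
  have Lu' : Lp_inputs p u' by exact: Lp_inputs_saturated uu'.
  rewrite Lp_enorm_le_norm//; last exact: Lp_inputsZ.
  rewrite (Lp_norm_seminorm p1).2// gtr0_norm ?invr_gt0// ler_pdivrMl// mulr1.
  apply: le_trans uc; apply: Lp_norm_ae_le => //.
  by apply: filterS uu' => s ->.
have mw : measurable_fun setT (fun s : measurableTypeR R => (`|w s|)%:E).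
  by apply/measurable_EFinP; exact: simple_limit_measurable_norm.
under eq_integral do rewrite EFinM.
rewrite ge0_integralZl_EFin//; [|exact: measurable_funTS|exact: ltW].
rewrite EFinM lee_pmul2l//.
apply: (@le_trans _ _ (\int[halfline]_(s in `[0%R, t]) (1 + (`|w s| `^
  r)%:E))%E).
  apply: ge0_ae_le_integral_nonmeas => //.
    by move=> s _; rewrite -EFinD lee_fin addr_ge0// powR_ge0.
  apply: aeW => s _; rewrite -EFinD lee_fin -/(w s).
  have [w1|/ltW w1] := leP `|w s| 1; first by rewrite (le_trans w1)// lerDl
    powR_ge0.
  rewrite (@le_trans _ _ (`|w s| `^ r))// ?lerDr//.
  by rewrite -[leLHS]powRr1// ler_powR.
rewrite ge0_integralD//; last first.
  by apply: measurable_funTS; exact: measurable_norm_powR.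
rewrite EFinD; apply: leeD.
  rewrite integral_cst// mul1e /= /mrestr setIidl//.
  by rewrite lebesgue_measure_itv/= ; case: ifP => _; rewrite ?sube0 ?lee_fin.
apply: le_trans Nw; apply: ge0_subset_integral => //.
exact: measurable_norm_powR.
Qed.

(** Absolute continuity of the integral of [`|u t| `^ r]. *)
Lemma Lp_norm_cut_small u e : Lp_inputs p u -> 0 < e ->
  exists2 dlt, 0 < dlt & forall A : set (measurableTypeR R), measurable A ->
    (leb A < dlt%:E)%E -> Lp_norm p (cut_input A u) <= e.
Proof.
move=> Lu e0.
have /strongly_measurableP[u' su uu'] := Lu.1.
have Lu' : Lp_inputs p u' by exact: Lp_inputs_saturated uu'.
have intu := integrable_norm_powR su Lu'.
have [dlt [d0 dP]] := integral_normr_continuous intu (powR_gt0 r e0).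
exists dlt => // A mA Ad.
have {}Ad : (halfline A < dlt%:E)%E.
  apply: le_lt_trans Ad; rewrite /= /mrestr; apply: le_measure; rewrite ?inE//.
  by apply: measurableI => //; exact: measurable_nonnegatives.
have LA := Lp_inputs_cut p1 mA Lu.
rewrite -Lp_enorm_le_norm//; apply/Lp_enorm_leP; first exact: ltW.
rewrite (_ : (\int[_]_t _)%E = (\int[halfline]_(t in A) (`|u' t| `^ r)%:E)%E).
  have := dP _ mA Ad; rewrite /Rintegral.
  have intA := integrableS measurableT mA (@subsetT _ _) intu.
  under eq_integral do rewrite ger0_norm ?powR_ge0//.
  move=> /ltW; rewrite -lee_fin fineK//.
  exact: integrable_fin_num.
rewrite [RHS]integral_mkcond; apply: ge0_ae_eq_integral_nonmeas => //.
- by move=> t _; rewrite patchE; case: ifP => // _; rewrite lee_fin powR_ge0.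
apply: filterS uu' => t ut _; rewrite patchE /cut_input; case: ifP => _.
  by rewrite ut.
by rewrite normr0 powR0// gt_eqF.
Qed.

(** The simple functions approximating [u] are set to [0] where they exceed
    [2 * `|u|], so that dominated convergence applies. *)
Lemma simple_dense u e : Lp_inputs p u -> 0 < e ->
  exists v, [/\ simple (v : measurableTypeR R -> U), Lp_inputs p v &
    Lp_norm p (u - v) <= e].
Proof.
move=> Lu e0.
have /strongly_measurableP[u' su uu'] := Lu.1.
have Lu' : Lp_inputs p u' by exact: Lp_inputs_saturated uu'.
have [s ss sE] := su.
have mnu : measurable_fun setT (fun t : measurableTypeR R => `|u' t|).
  exact: simple_limit_measurable_norm.
pose E n : set (measurableTypeR R) := [set t | `|s n t| <= 2 * `|u' t|].
have mE n : measurable (E n).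
  rewrite -[X in measurable X]setTI; apply: measurable_fun_le => //.
    exact: simple_limit_measurable_norm (simple_simple_limit (ss n)).
  exact: measurable_funM.
pose v n t : U := if t \in E n then s n t else 0.
have sv n : simple (v n : measurableTypeR R -> U).
  by have := simple_comp (fun c : bool * U => if c.1 then c.2 else 0)
    (simple_pair (simple_mem (mE n)) (ss n)).
have vu n t : `|v n t| <= 2 * `|u' t|.
  rewrite /v; case: ifP => [/set_mem//|_].
  by rewrite normr0 mulr_ge0.
have vE t : v n t @[n --> \oo] --> u' t.
  have [u0|u0] := eqVneq (u' t) 0.
    rewrite u0; apply: cvg_near_cst; apply: nearW => n.
    by apply/eqP; rewrite -normr_le0 (le_trans (vu n t))// u0 normr0 mulr0.
  apply: cvg_trans (sE t); apply: near_eq_cvg.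
  have u2 : `|u' t| < 2 * `|u' t| by rewrite ltr_pMl ?normr_gt0// ltr1n.
  near=> n; rewrite /v mem_set//; apply: ltW.
  by near: n; exact: cvgr_lt (cvg_norm (sE t)) _ u2.
have cvr t : (`|u' t - v n t| `^ r)%:E @[n --> \oo] --> 0%E.
  apply/fine_cvgP; split; first exact: nearW.
  rewrite /comp /= -[X in _ --> X](powR0 (lt0r_neq0 r0)).
  apply: cvg_powR => //.
  rewrite -(@normr0 _ U) -[X in `|X|](subrr (u' t)).
  by apply: cvg_norm; apply: cvgB; [exact: cvg_cst|exact: vE].
have int3 : halfline.-integrable setT (fun t => ((3 * `|u' t|) `^ r)%:E).
  apply: (eq_integrable _ (fun t => ((3 `^ r)%:E * (`|u' t| `^ r)%:E)%E)) => //.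
    by move=> t _; rewrite powRM.
  by apply: integrableZl => //; exact: integrable_norm_powR.
have [||||_ _ cv] := @dominated_convergence _ _ R halfline setT measurableT
  (fun n t => (`|u' t - v n t| `^ r)%:E) (cst 0%E)
  (fun t => ((3 * `|u' t|) `^ r)%:E) _ _ _ int3.
- by move=> n; exact: measurable_norm_powR (simple_limitB su
  (simple_simple_limit (sv n))).
- exact: measurable_cst.
- by apply: aeW => t _; exact: cvr.
- apply: aeW => t n _; rewrite /= ger0_norm ?powR_ge0// lee_fin.
  apply: ge0_ler_powR; rewrite ?nnegrE ?mulr_ge0 ?(ltW r0)//.
  apply: (le_trans (ler_normB _ _)); have := vu n t; lra.
rewrite integral0 in cv.
have er0 : 0 < e `^ r by exact: powR_gt0.
have nb0 : nbhs 0%E [set y | (y < (e `^ r)%:E)%E].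
  by apply: open_nbhs_nbhs; split; [exact: open_ereal_lt_ereal|rewrite /=
    lte_fin].
have [N _ NP] := cv _ nb0.
exists (v N).
have Lv : Lp_inputs p (v N).
  apply: (@Lp_inputs_dominated _ _ _ p1 _ (2 *: u')).
  - exact: Lp_inputsZ.
  - apply/strongly_measurableP; exists (v N); last exact: aeW.
    exact: simple_simple_limit.
  - by apply: aeW => t; rewrite normrZ ger0_norm.
split => //.
rewrite -Lp_enorm_le_norm//; last exact: Lp_inputsB.
have -> : Lp_enorm p (u - v N) = Lp_enorm p (u' - v N).
  by apply: Lnorm_norm_ae_eq => //; apply: filterS uu' => t ut;
    rewrite !fctE ut.
by apply/Lp_enorm_leP; [exact: ltW|apply: ltW; exact: NP N (leqnn N)].
Unshelve. all: by end_near. Qed.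

(** Local integrability gives the convergence of the series almost everywhere,
    and Fatou's lemma bounds its tails. *)
Lemma Lp_norm_series (v : nat -> R -> U) :
  (forall k, simple (v k : measurableTypeR R -> U) /\ Lp_inputs p (v k)) ->
  (forall k, Lp_norm p (v k) <= 2^-1 ^+ k) ->
  exists2 u, Lp_inputs p u & forall n c,
    (forall m, (n <= m)%N -> Lp_norm p (\sum_(n <= k < m) v k) <= c) ->
    Lp_norm p (u - \sum_(0 <= k < n) v k) <= c.
Proof.
move=> vP vk.
have geo (n : nat) : \sum_(0 <= k < n) 2^-1 ^+ k <= 2 :> R.
  suff : \sum_(0 <= k < n) 2^-1 ^+ k = 2 - 2 * 2^-1 ^+ n :> R.
    by move=> ->; rewrite gerBl mulr_ge0// exprn_ge0.
  elim: n => [|n IH]; first by rewrite big_geq// expr0 mulr1 subrr.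
  by rewrite big_nat_recr//= IH exprS; field.
have mv k : measurable_fun setT (fun t : measurableTypeR R => (`|v k t|)%:E).
  apply/measurable_EFinP; apply: simple_limit_measurable_norm.
  by apply: simple_simple_limit; exact: (vP k).1.
have Lsum n m : Lp_inputs p (\sum_(n <= k < m) v k).
  apply: (big_ind (@Lp_inputs R U p)).
  - exact: (Lp_inputs_linear p1).1.
  - by move=> f g Lf Lg; exact: Lp_inputsD.
  - by move=> k _; exact: (vP k).2.
have sum_apply n m t : (\sum_(n <= k < m) v k) t = \sum_(n <= k < m) v k t.
  by apply: (big_morph (fun f : R -> U => f t)).
have ssum n m : simple (\sum_(n <= k < m) v k : measurableTypeR R -> U).
  apply: (big_ind (fun f => simple (f : measurableTypeR R -> U))).
  - exact: simple_cst.
  - move=> f g sf sg.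
    by have := simple_comp (fun c => c.1 + c.2) (simple_pair sf sg).
  - by move=> k _; exact: (vP k).1.
have cvg_loc (T : nat) : \forall t \ae leb, `[0, T%:R]%classic t ->
    cvgn (series (fun k => v k t)).
  pose D : set (measurableTypeR R) := `[0, T%:R]%classic.
  have mD : measurable D by exact: measurable_itv.
  have mvD k : measurable_fun D (fun t => (`|v k t|)%:E) by exact:
    measurable_funTS.
  have int : leb.-integrable D (fun t => (\sum_(0 <= k <oo) (`|v k t|)%:E)%E).
    apply/integrableP; split; first exact: ge0_emeasurable_sum.
    under eq_integral do rewrite gee0_abs ?nneseries_ge0//.
    rewrite integral_nneseries//.
    apply: (@le_lt_trans _ _ (2 * (T%:R + 1))%:E); last exact: ltry.
    apply: lime_le.
      by apply: is_cvg_nneseries => k _ _; exact: integral_ge0.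
    apply: nearW => n.
    apply: (@le_trans _ _ (\sum_(0 <= k < n) (2^-1 ^+ k * (T%:R + 1))%:E)%E).
      apply: lee_sum => k _; have k0 : 0 < 2^-1 ^+ k :> R by rewrite exprn_gt0.
      exact: integral_norm_le_Lp_norm k0 (ler0n _ _) (vP k).2 (vk k).
    rewrite sumEFin lee_fin -mulr_suml ler_wpM2r ?addr_ge0//; exact: geo.
  apply: filterS (integrable_ae mD int) => t fint Dt.
  apply: normed_cvg; apply: nondecreasing_is_cvgn.
    by apply/nondecreasing_seqP => n; rewrite /= !seriesEnat/= big_nat_recr//=
      lerDl.
  exists (fine (\sum_(0 <= k <oo) (`|v k t|)%:E)%E) => _ [n _ <-].
  rewrite /= seriesEnat/= -lee_fin fineK; last exact: fint.
  rewrite -sumEFin; exact: nneseries_lim_ge.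
have cvg_ae : \forall t \ae halfline, cvgn (series (fun k => v k t)).
  apply/ae_lebesgue_nonneg; apply: filterS (ae_foralln cvg_loc) => t ct t0.
  apply: (ct (Num.truncn t).+1); rewrite /= in_itv/= t0/=.
  by apply: ltW; exact: truncnS_gt.
pose u t := limn (series (fun k => v k t)).
have su : strongly_measurable halfline u.
  have /choice[s sE] := fun n => simple_fimfun (ssum 0 n).
  exists s; first by move=> n c; rewrite sE; exact: (ssum 0 n).2.
  apply: filterS cvg_ae => t ct.
  under eq_fun do rewrite sE sum_apply.
  exact: ct.
have tail n c : (forall m, (n <= m)%N -> Lp_norm p (\sum_(n <= k < m) v k) <=
  c) ->
    (Lp_enorm p (u - \sum_(0 <= k < n) v k)%R <= c%:E)%E.
  move=> hc.
  have c0 : 0 <= c by apply: le_trans (hc n (leqnn n)); exact: Lp_norm_ge0.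
  apply/Lp_enorm_leP => //.
  pose w m : measurableTypeR R -> U := \sum_(0 <= k < m) v k - \sum_(0 <= k <
    n) v k.
  have wE m : (n <= m)%N -> w m = \sum_(n <= k < m) v k.
    by move=> nm; rewrite /w (big_cat_nat (leq0n n) nm)/= addrAC subrr add0r.
  have sw m : simple_limit (w m).
    by apply: simple_limitB; apply: simple_simple_limit; exact: ssum.
  apply: (@le_trans _ _ (\int[halfline]_t limn_einf (fun m => (`|w m t| `^
    r)%:E))%E).
    apply: ge0_ae_le_integral_nonmeas => //.
      move=> t _; rewrite limn_einf_lim; apply: lime_ge;
        first exact: is_cvg_einfs.
      apply: nearW => k; apply: le_ereal_inf_tmp => _ [m _ <-].
      by rewrite lee_fin powR_ge0.
    apply: filterS cvg_ae => t ct _.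
    have /cvg_limn_einf_sup[-> _] : (fun m => (`|w m t| `^ r)%:E) @ \oo -->
        (`|(u - \sum_(0 <= k < n) v k) t| `^ r)%:E.
      apply/fine_cvgP; split; first exact: nearW.
      apply: cvg_powR => //; apply: cvg_norm.
      have -> : (w ^~ t) = (fun m => series (fun k => v k t) m -
          (\sum_(0 <= k < n) v k) t).
        by apply/funext => m; rewrite seriesEnat/= -sum_apply.
      by apply: cvgB; [exact: ct|exact: cvg_cst].
    by [].
  have mw m := measurable_norm_powR (sw m).
  apply: (le_trans (fatou halfline measurableT mw _)).
    by move=> m t _; rewrite lee_fin powR_ge0.
  rewrite limn_einf_lim; apply: lime_le; first exact: is_cvg_einfs.
  apply: nearW => k; apply: (@le_trans _ _
    (\int[halfline]_t (`|w (maxn k n) t| `^ r)%:E)%E).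
    by apply: ereal_inf_lbound; exists (maxn k n) => //=; exact: leq_maxl.
  apply/(Lp_enorm_leP _ c0); rewrite wE ?leq_maxr//.
  by rewrite Lp_enorm_le_norm//; apply: hc; exact: leq_maxr.
have Lu : Lp_inputs p u.
  split => //; apply: (@le_lt_trans _ _ 2%:E); last exact: ltry.
  have := tail 0%N 2; rewrite [X in Lp_enorm _ (_ - X)]big_geq// subr0; apply.
  move=> m _; apply: le_trans (geo m).
  elim: m => [|m IH].
    by rewrite !big_geq// -(scale0r (v 0)) (Lp_norm_seminorm p1).2 ?normr0
      ?mul0r//; exact: (vP 0).2.
  rewrite !big_nat_recr//=; apply: (le_trans ((Lp_norm_seminorm p1).1 _ _ (Lsum
    _ _) (vP m).2)).
  by apply: lerD.
exists u => // n c hc; rewrite -Lp_enorm_le_norm//; first exact: tail.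
exact: Lp_inputsB.
Qed.

End finite_exponent.

(** * Semigroups *)

Lemma within_nonnegatives_continuousP (R : realType) (V : normedModType R)
    (f : R -> V) :
  {within nonnegatives, continuous f} <->
  forall t e, 0 <= t -> 0 < e -> exists2 dlt, 0 < dlt &
    forall s, 0 <= s -> `|s - t| < dlt -> `|f s - f t| < e.
Proof.
rewrite subspace_continuousP; split=> [cf t e t0 e0|cf t t0].
  have /cvgrPdist_lt/(_ _ e0) := cf t t0.
  rewrite near_withinE => /nbhs_ballP[dlt /= d0 dP].
  exists dlt => // s s0 std; rewrite distrC; apply: dP => //.
  by rewrite /ball/= distrC.
apply/cvgrPdist_lt => e e0; rewrite near_withinE.
have [dlt d0 dP] := cf t e t0 e0.
apply/nbhs_ballP; exists dlt => //= s st s0.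
by rewrite distrC; apply: dP => //; rewrite distrC.
Qed.

Section semigroup_theory.
Context {R : realType} {X : normedModType R} (S : R -> X -> X).
Hypothesis hS : C0_semigroup S.

Lemma semigroup_linear_map t : 0 <= t ->
  exists2 L : {linear X -> X}, L = S t :> (X -> X) & continuous L.
Proof.
move=> t0.
pose m := GRing.isLinear.Build R X X *:%R (S t) (semigroup_linear hS t0).
pose L : {linear X -> X} := HB.pack (S t) m.
by exists L => //; exact: semigroup_bounded.
Qed.

Lemma semigroup_norm_le t : 0 <= t ->
  exists2 M, 0 <= M & forall x, `|S t x| <= M * `|x|.
Proof.
move=> t0; have [L LS cL] := semigroup_linear_map t0.
have /linear_boundedP[M [_ LM]] : bounded_near L (nbhs 0).
  exact/linear_bounded_continuous.
exists (`|M| + 1); first by rewrite addr_ge0.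
by move=> x; rewrite -LS; apply: LM; rewrite ltr_pwDr// ler_norm.
Qed.

End semigroup_theory.

(** Orbits are bounded on compact intervals, and by the Banach-Steinhaus theorem
    uniformly so. *)
Lemma semigroup_locally_bounded (R : realType) (X : completeNormedModType R)
    (S : R -> X -> X) (T : R) :
  C0_semigroup S ->
  exists2 M, 0 <= M & forall t x, 0 <= t <= T -> `|S t x| <= M * `|x|.
Proof.
move=> hS.
pose F : set (X -> X) := [set S t | t in `[0, T]].
have Flin f : F f -> bounded_fun_norm f /\ linear f.
  move=> [t /= tT <-]; have t0 : 0 <= t by move: tT;
    rewrite in_itv/= => /andP[].
  split; last exact: semigroup_linear hS _ t0.
  have [M M0 SM] := semigroup_norm_le hS t0.
  move=> r; exists (M * r) => x xr; apply: le_trans (SM x) _.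
  by rewrite ler_wpM2l.
have Fpt : pointwise_bounded F.
  move=> x.
  have T0 : `[0, T]%classic `<=` nonnegatives.
    by move=> t /=; rewrite in_itv/= => /andP[].
  have cSx : {within `[0, T], continuous (fun t => S t x)}.
    apply: (@continuous_subspaceW _ _ _ nonnegatives) => //.
    exact: semigroup_continuous.
  have /compact_bounded[M [_ BM]] := continuous_compact cSx (@segment_compact R
    0 T).
  exists (M + 1) => f [t tT <-]; apply: (BM (M + 1)); first by rewrite ltrDl.
  by exists t.
have [M FM] := Banach_Steinhauss Flin Fpt 1.
exists `|M| => // t x tT.
have FSt : F (S t) by exists t => //; rewrite /= in_itv.
have [->|x0] := eqVneq x 0.
  by rewrite (_ : S t 0 = 0) ?normr0 ?mulr0//; have [] := andP tT => t0 _;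
    have [L <- _] := semigroup_linear_map hS t0; rewrite linear0.
have [t0 _] := andP tT; have [L LS _] := semigroup_linear_map hS t0.
have x0' : 0 < `|x| by rewrite normr_gt0.
have := FM _ FSt (`|x|^-1 *: x).
rewrite normrZ normfV normr_id mulVf ?gt_eqF// lexx => /(_ isT).
rewrite -LS linearZ normrZ normfV normr_id ler_pdivrMl// mulrC => /le_trans.
by apply; rewrite ler_wpM2r// ler_norm.
Qed.

(** * The input map *)

Section input_maps.
Context {R : realType} {X U : normedModType R} {Y : normedModType R}.
Variables (S : R -> X -> X) (j : {linear X -> Y}) (Sm1 : R -> Y -> Y)
  (B : {linear U -> Y}).
Hypotheses (hSm1 : C0_semigroup Sm1) (hext : extends_semigroup j S Sm1).
Hypothesis j_inj : injective j.
Local Notation leb := (@lebesgue_measure R).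
Local Notation is_Phi := (is_input_map j Sm1 B).

#[local] Existing Instance ae_lebesgue_filter.

Let mitv (t : R) : measurable (`[0, t]%classic : set (measurableTypeR R)).
Proof. exact: measurable_itv. Qed.

Let finitv (t : R) : (leb `[0%R, t]%classic < +oo)%E.
Proof.
by rewrite lebesgue_measure_itv/=; case: ifP => _ //; rewrite -EFinB ltry.
Qed.

Lemma is_input_map_ae_eq t u v x :
  (\forall s \ae leb, 0 <= s <= t -> u s = v s) ->
  is_Phi t u x -> is_Phi t v x.
Proof.
move=> uv; apply: (is_bochner_integral_ae_eq (mitv t) (finitv t)).
by apply: filterS uv => s uv; rewrite /= in_itv/= => /uv ->.
Qed.

Lemma is_input_map_unique t u x y : is_Phi t u x -> is_Phi t u y -> x = y.
Proof.
move=> ux uy; apply: j_inj.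
by apply: (is_bochner_integral_unique (mitv t) (finitv t) _ ux uy); exact: aeW.
Qed.

Lemma is_input_map_linear (a : R) t u v x y :
  is_Phi t u x -> is_Phi t v y ->
  is_Phi t (fun s => a *: u s + v s) (a *: x + y).
Proof.
move=> ux vy; rewrite /is_input_map linearP.
apply: (is_bochner_integral_ae_eq (mitv t) (finitv t))
  (is_bochner_integral_linear
  (mitv t) (finitv t) a ux vy).
apply: aeW => s; rewrite /= in_itv/= => /andP[_ st].
by rewrite linearP semigroup_linear// subr_ge0.
Qed.

Lemma is_input_map0 t : is_Phi t (fun=> 0) 0.
Proof.
rewrite /is_input_map (linear0 B) (linear0 j).
apply/(is_bochner_integralP (mitv t) (finitv t)); exists (fun=> 0).
  apply: aeW => s; rewrite /= in_itv/= => /andP[_ st].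
  have [L <- _] : exists2 L : {linear Y -> Y}, L = Sm1 (t - s) :> (Y -> Y) &
    continuous L.
    by apply: semigroup_linear_map => //; rewrite subr_ge0.
  by rewrite linear0.
have sint0 : sint leb `[0, t]%classic (fun=> 0 : Y) = 0.
  rewrite /sint; apply: fsbig1 => v [s _ <-].
  by rewrite scaler0.
exists (fun=> fun=> 0); split => //.
- by move=> n; exact: simple_cst.
- by move=> s; exact: cvg_cst.
- under eq_fun do under eq_integral do rewrite subrr normr0.
  by under eq_fun do rewrite integral0; exact: cvg_cst.
- by under eq_fun do rewrite sint0; exact: cvg_cst.
Qed.

(** The integral up to [t + s] splits at [s]; the operator [Sm1 t] is taken out
    of the first part, and the second one is translated. *)
Lemma is_input_map_cocycle s t u x y : 0 <= s -> 0 <= t ->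
  is_Phi s u x -> is_Phi t (shift_input s u) y -> is_Phi (t + s) u (S t x + y).
Proof.
move=> s0 t0 ux uy; have [L LS cL] := semigroup_linear_map hSm1 t0.
set D : set (measurableTypeR R) := `[0, s]%classic.
set E : set (measurableTypeR R) := `[0, t + s]%classic.
have DE : D `<=` E.
  move=> r; rewrite /D /E /= !in_itv/= => /andP[-> rs].
  by rewrite (le_trans rs)// lerDr.
have := is_bochner_integral_restrict (mitv s) (mitv (t + s)) DE (finitv _)
  (is_bochner_integral_linear_map (mitv s) (finitv s) cL ux).
rewrite LS hext// => b1.
pose phi (r : measurableTypeR R) : measurableTypeR R := r - s.
have mphi : measurable_fun setT phi by exact: measurable_translation.
have phileb A : measurable A -> leb (phi @^-1` A) = leb A.
  exact: lebesgue_measure_translation.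
pose D' : set (measurableTypeR R) := phi @^-1` `[0, t]%classic.
have mD' : measurable D'.
  by rewrite -[X in measurable X]setTI; apply: mphi => //; exact: mitv.
have D'E : D' `<=` E.
  move=> r; rewrite /D' /E /phi /= !in_itv/= subr_ge0 lerBlDr => /andP[sr ->].
  by rewrite (le_trans s0).
have b2 := is_bochner_integral_restrict mD' (mitv (t + s)) D'E (finitv _)
  (is_bochner_integral_measure_preserving (mitv t) (finitv t) mphi phileb uy).
rewrite /is_input_map linearD.
have b12 := is_bochner_integral_linear (mitv (t + s)) (finitv _) 1 b1 b2.
rewrite scale1r in b12.
apply: (is_bochner_integral_ae_eq (mitv _) (finitv _)) b12.
exists [set s]; split => //; first exact: lebesgue_measure_set1.
move=> r /= H; apply: contrapT => rs; apply: H.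
rewrite /E /= in_itv/= => /andP[r0 rts].
have [sr|sr|sr] := ltgtP r s; last by case: rs.
  rewrite mem_set; last by rewrite /D /= in_itv/= r0 ltW.
  rewrite memNset ?scale1r ?addr0; last first.
    by rewrite /D' /phi/= in_itv/= subr_ge0 leNgt sr.
  have sr0 : 0 <= s - r by rewrite subr_ge0 ltW.
  by rewrite -addrA [RHS](semigroupD hSm1).
rewrite memNset; last by rewrite /D /= in_itv/= r0 leNgt sr.
rewrite mem_set ?scaler0 ?add0r; last first.
  by rewrite /D' /phi/= in_itv/= subr_ge0 lerBlDr ltW.
by rewrite /= /phi /shift_input subrK opprB addrA addrAC.
Qed.

Lemma is_input_map_norm t u x : is_Phi t u x ->
  ((`|j x|)%:E <= \int[leb]_(s in `[0%R, t]) (`|Sm1 (t - s)%R (B (u s))|)%:E)%E.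
Proof. by move=> ux; have := is_bochner_integral_norm (mitv t) (finitv t) ux.
  Qed.

End input_maps.

(** * Bounded approximations of the identity from the extrapolation norm *)

Section resolvent_approximation.
Context {R : realType} {X : normedModType R} (S : R -> X -> X).
Hypothesis hS : C0_semigroup S.
Variables (lambda : R) (Q : {linear X -> X}).
Hypothesis hQ : is_resolvent (generator S) lambda Q.

(** With [z] the resolvent of [x], the difference quotients of the orbit of [z]
    converge to [lambda *: z - x].  Each [resolvent_approx n] is thus bounded
      for
    the norm of the extrapolation space, and they converge to the identity. *)
Definition resolvent_approx (n : nat) (x : X) : X :=
  lambda *: Q x - (n.+1%:R^-1)^-1 *: (S n.+1%:R^-1 (Q x) - Q x).

Lemma resolvent_approx_linear n : linear (resolvent_approx n).
Proof.
have n0 : 0 <= n.+1%:R^-1 :> R by rewrite invr_ge0.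
have [L LS _] := semigroup_linear_map hS n0.
have -> : resolvent_approx n =
    lambda \*: Q \- (n.+1%:R^-1)^-1 \*: ((L \o Q) \- Q).
  by apply/funext => x; rewrite /resolvent_approx -LS.
exact: linearP.
Qed.

Lemma resolvent_approx_bounded n :
  exists2 c, 0 <= c & forall x, `|resolvent_approx n x| <= c * `|Q x|.
Proof.
have n0 : 0 <= n.+1%:R^-1 :> R by rewrite invr_ge0.
have [M M0 SM] := semigroup_norm_le hS n0.
exists (`|lambda| + n.+1%:R * (M + 1)).
  by rewrite addr_ge0// mulr_ge0// addr_ge0.
move=> x; rewrite /resolvent_approx invrK mulrDl.
apply: (le_trans (ler_normB _ _)); rewrite !normrZ lerD2l -mulrA ger0_norm//.
rewrite ler_wpM2l// (le_trans (ler_normB _ _))// mulrDl mul1r lerD2r.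
exact: SM.
Qed.

Lemma resolvent_approx_cvg x : resolvent_approx n x @[n --> \oo] --> x.
Proof.
have [_ QA _] := hQ; have := QA x; rewrite /generator /=.
set l := lambda *: Q x - x => /cvgrPdist_lt lim.
apply/cvgrPdist_lt => e e0; have := lim _ e0.
rewrite near_withinE => /nbhs_ballP[d /= d0 dP].
near=> n; have h0 : 0 < n.+1%:R^-1 :> R by rewrite invr_gt0.
have hd : n.+1%:R^-1 < d by near: n; exact: (near_infty_natSinv_lt (PosNum d0)).
have := dP n.+1%:R^-1; rewrite /ball/= sub0r normrN gtr0_norm// => /(_ hd h0).
rewrite -normrN; congr (`|_| < _).
by rewrite /resolvent_approx /l !opprB addrCA.
Unshelve. all: by end_near. Qed.

Lemma resolvent_injective : injective Q.
Proof.
move=> x y Qxy.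
have E : resolvent_approx^~ x = resolvent_approx^~ y.
  by apply/funext => n; rewrite /resolvent_approx Qxy.
have cx := @resolvent_approx_cvg x; rewrite E in cx.
exact: (cvg_unique (@norm_hausdorff _ _) cx (@resolvent_approx_cvg y)).
Qed.

End resolvent_approximation.

(** * The control system *)

Section control_systems.
Context {R : realType} {X U : completeNormedModType R} {Y :
  completeNormedModType R}.
Variables (p : \bar R) (S : R -> X -> X) (j : {linear X -> Y})
  (Sm1 : R -> Y -> Y) (B : {linear U -> Y}).
Hypotheses (p1 : (1 <= p)%E) (hS : C0_semigroup S) (hSm1 : C0_semigroup Sm1).
Hypotheses (hext : extends_semigroup j S Sm1) (hB : continuous B).
Hypothesis hadm : admissible j Sm1 B (Lp_inputs p).
Variables (lambda : R) (Q : {linear X -> X}).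
Hypotheses (hQ : is_resolvent (generator S) lambda Q).
Hypothesis jQ : forall x, `|j x| = `|Q x|.
Local Notation leb := (@lebesgue_measure R).
Local Notation halfline := (@lebesgue_nonneg R).
Local Notation Phi := (input_map j Sm1 B).
Implicit Types u v : R -> U.

#[local] Existing Instance ae_halfline_filter.
#[local] Existing Instance ae_lebesgue_filter.

Let j_inj : injective j.
Proof.
move=> x y jxy; apply: (resolvent_injective hQ); apply/eqP.
by rewrite -subr_eq0 -linearB -normr_eq0 -jQ linearB jxy subrr normr0.
Qed.

Let Phi_is t u : 0 <= t -> Lp_inputs p u -> is_input_map j Sm1 B t u (Phi t u).
Proof. by move=> t0 Lu; apply: getPex; exact: hadm. Qed.

Let Phi_eq t u x : 0 <= t -> Lp_inputs p u -> is_input_map j Sm1 B t u x ->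
  Phi t u = x.
Proof. by move=> t0 Lu ux; exact: is_input_map_unique j_inj _ _ _ _ (Phi_is t0
  Lu) ux. Qed.

Let Phi_ae_eq t u v : 0 <= t -> Lp_inputs p u -> Lp_inputs p v ->
  (\forall s \ae leb, 0 <= s <= t -> u s = v s) -> Phi t u = Phi t v.
Proof.
move=> t0 Lu Lv uv; apply/esym; apply: Phi_eq => //.
by apply: is_input_map_ae_eq uv _; exact: Phi_is.
Qed.

Let Phi_linear t (a : R) u v : 0 <= t -> Lp_inputs p u -> Lp_inputs p v ->
  Phi t (fun s => a *: u s + v s) = a *: Phi t u + Phi t v.
Proof.
move=> t0 Lu Lv; apply: Phi_eq => //; first exact: Lp_inputs_lin.
by apply: is_input_map_linear => //; exact: Phi_is.
Qed.

Lemma input_map_fun0 t : 0 <= t -> Phi t (fun=> 0) = 0.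
Proof.
move=> t0; apply: Phi_eq => //; first exact: (Lp_inputs_linear p1).1.
exact: is_input_map0.
Qed.

Lemma input_map_time0 u : Lp_inputs p u -> Phi 0 u = 0.
Proof.
move=> Lu; rewrite -(input_map_fun0 (lexx 0)); apply: Phi_ae_eq => //.
  exact: (Lp_inputs_linear p1).1.
exists [set 0]; split => //; first exact: lebesgue_measure_set1.
move=> s /= H; apply: contrapT => s0; apply: H => /le_anti /esym.
by move=> /s0.
Qed.

Lemma input_map_causal t u v : 0 <= t -> Lp_inputs p u -> Lp_inputs p v ->
  eq_upto (almost_everywhere halfline) `[0, t] u v -> Phi t u = Phi t v.
Proof.
move=> t0 Lu Lv uv; apply: Phi_ae_eq => //.
have /ae_lebesgue_nonneg := uv; apply: filterS => s H /[dup] /andP[s0 _] st.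
by apply: H; rewrite //= in_itv.
Qed.

Lemma input_map_cocycle s t u : 0 <= s -> 0 <= t -> Lp_inputs p u ->
  Phi (t + s) u = S t (Phi s u) + Phi t (shift_input s u).
Proof.
move=> s0 t0 Lu; apply: Phi_eq => //; first exact: addr_ge0.
apply: is_input_map_cocycle => //; apply: Phi_is => //.
exact: Lp_inputs_shift.
Qed.

(** This reduces the input maps at short times to the one at time [1], so that
    a bound for the latter is a bound for all of them. *)
Lemma input_map_delay s t u : 0 <= s -> 0 <= t -> Lp_inputs p u ->
  Phi (t + s) (delay_input s u) = Phi t u.
Proof.
move=> s0 t0 Lu; have Ld := Lp_inputs_delay p1 s0 Lu.
rewrite input_map_cocycle//.
have -> : Phi s (delay_input s u) = 0.
  rewrite -(input_map_fun0 s0); apply: Phi_ae_eq => //;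
    first exact: (Lp_inputs_linear p1).1.
  exists [set s]; split => //; first exact: lebesgue_measure_set1.
  move=> r /= H; apply: contrapT => rs; apply: H => /andP[_ rles].
  rewrite /delay_input /concat_input lt_neqAle rles andbT.
  by case: eqP => // /rs.
have [L <- _] := semigroup_linear_map hS t0; rewrite linear0 add0r.
apply: Phi_ae_eq => //; first exact: Lp_inputs_shift.
apply: aeW => r /andP[r0 _].
by rewrite /shift_input /delay_input /concat_input ltNge lerDr r0 addrK.
Qed.

(** The norm of a Bochner integral is at most the integral of the norm, and L^p
    embeds into L^1 on bounded intervals. *)
Let j_Phi_bounded r : p = r%:E ->
  exists2 K, 0 <= K & forall u, Lp_inputs p u -> `|j (Phi 1 u)| <= K * Lp_norm
    p u.
Proof.
move=> pr; have r1 : 1 <= r by rewrite -lee_fin -pr.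
have [M M0 SM] := semigroup_locally_bounded 1 hSm1.
have /linear_boundedP[b [_ Bb]] : bounded_near B (nbhs 0).
  exact/linear_bounded_continuous.
pose c := M * (`|b| + 1).
have c0 : 0 <= c by rewrite mulr_ge0// addr_ge0.
exists (c * 2); first by rewrite mulr_ge0.
move=> u Lu; apply/ler_addgt0Pr => e e0.
have Lcu : Lp_inputs p (c *: u) by exact: Lp_inputsZ.
have := is_input_map_norm (Phi_is ler01 Lu).
move=> /le_trans => /(_ (\int[leb]_(s in `[0%R, 1%R]) (`|(c *: u) s|)%R%:E)%E)
  H.
rewrite -lee_fin; apply: le_trans (H _) _.
  apply: ge0_ae_le_integral_nonmeas => //.
  apply: aeW => s; rewrite /= in_itv/= => /andP[s0 s1]; rewrite lee_fin.
  rewrite fctE normrZ (ger0_norm c0) /c -mulrA.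
  apply: (le_trans (SM _ _ _)); first by rewrite subr_ge0 s1 gerBl.
  rewrite ler_wpM2l//; apply: Bb.
  by rewrite ltr_pwDr// ler_norm.
have e2 : 0 < e / 2 by rewrite divr_gt0.
apply: le_trans.
  apply: (@integral_norm_le_Lp_norm _ _ _ r1 _ (Lp_norm p (c *: u) + e / 2) 1)
    => //.
  - by rewrite ltr_wpDl// Lp_norm_ge0.
  - by rewrite -pr.
  - by rewrite -pr lerDl ltW.
rewrite lee_fin (Lp_norm_seminorm p1).2// ger0_norm// mulrDl.
by rewrite (_ : 1 + 1 = 2)// divfK// lerD2r mulrAC.
Qed.

(** The operators [resolvent_approx n \o Phi 1] are bounded, since [j \o Phi 1]
    is; they converge pointwise to [Phi 1], so they are uniformly bounded, and
    the bound passes to the limit.  Uniform boundedness yields the bound on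
    simple functions, and density extends it to L^p. *)
Lemma input_map_bounded r : p = r%:E ->
  exists2 C, 0 <= C & forall u, Lp_inputs p u -> `|Phi 1 u| <= C * Lp_norm p u.
Proof.
move=> pr; have r1 : 1 <= r by rewrite -lee_fin -pr.
have [K K0 jK] := j_Phi_bounded pr.
pose q n u := `|resolvent_approx S lambda Q n (Phi 1 u)|.
have /choice[c cP] : forall n, exists c, 0 <= c /\
    forall u, Lp_inputs p u -> q n u <= c * Lp_norm p u.
  move=> n; have [c c0 qc] := resolvent_approx_bounded hS lambda Q n.
  exists (c * K); split; first exact: mulr_ge0.
  move=> u Lu; apply: (le_trans (qc _)).
  by rewrite -jQ -mulrA ler_wpM2l//; exact: jK.
have q_seminorm n : seminorm_on (Lp_inputs p) (q n).
  have rl := resolvent_approx_linear hS lambda Q n.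
  split=> [u v Lu Lv|a u Lu]; rewrite /q.
    have -> : Phi 1 (u + v) = Phi 1 u + Phi 1 v.
      have := Phi_linear 1 ler01 Lu Lv; rewrite scale1r => <-.
      by congr (Phi 1 _); apply/funext => s; rewrite scale1r.
    have := rl 1 (Phi 1 u) (Phi 1 v); rewrite !scale1r => ->.
    exact: ler_normD.
  have -> : Phi 1 (a *: u) = a *: Phi 1 u.
    have := Phi_linear a ler01 Lu (Lp_inputs_linear p1).1.
    rewrite input_map_fun0// addr0 => <-.
    by congr (Phi 1 _); apply/funext => s; rewrite addr0.
  have rl0 : resolvent_approx S lambda Q n 0 = 0.
    by have := rl (-1) 0 0; rewrite scaler0 addr0 scaleN1r addNr.
  by have := rl a (Phi 1 u) 0; rewrite !addr0 rl0 addr0 => ->; rewrite normrZ.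
have q_pointwise u : Lp_inputs p u -> exists M, forall n, q n u <= M.
  move=> Lu.
  have cv : cvgn (fun n => resolvent_approx S lambda Q n (Phi 1 u)).
    by apply/cvg_ex; exists (Phi 1 u); exact: resolvent_approx_cvg.
  have [M [_ BM]] := cvg_seq_bounded cv.
  by exists (M + 1) => n; apply: (BM (M + 1)) => //; rewrite ltrDl.
pose W : set (R -> U) := [set u | simple (u : measurableTypeR R -> U) /\
  Lp_inputs p u].
have [C0 C0P] : exists C, forall n u, W u -> q n u <= C * Lp_norm p u.
  apply: (@uniform_boundedness _ _ W (Lp_inputs p) (Lp_norm p) _ _ _ _ _ _ q c)
    => //.
  - by move=> u [].
  - move=> a u [su Lu]; split; last exact: Lp_inputsZ.
    exact: (simple_comp (fun x => a *: x) su).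
  - by move=> a u v Lu Lv; exact: Lp_inputs_lin.
  - exact: Lp_norm_seminorm.
  - move=> v vW vk; have := @Lp_norm_series R U r r1 v; rewrite -pr => h.
    exact: h vW vk.
  - by move=> n u Lu; exact: (cP n).2.
exists `|C0| => // u Lu.
have qC n : q n u <= `|C0| * Lp_norm p u.
  have [c0 qc] := cP n.
  apply/ler_addgt0Pr => e e0.
  pose e' := e / (c n + `|C0|+ 1).
  have d0 : 0 < c n + `|C0| + 1 by rewrite ltr_wpDl// addr_ge0.
  have e'0 : 0 < e' by exact: divr_gt0.
  have [v [sv Lv uve]] : exists v, [/\ simple (v : measurableTypeR R -> U),
      Lp_inputs p v & Lp_norm p (u - v) <= e'].
    by move: Lu; rewrite pr => Lu; exact: simple_dense.
  have Luv := Lp_inputsB p1 Lu Lv.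
  have qsub : q n u <= q n v + q n (u - v).
    by have := (q_seminorm n).1 _ _ Lv Luv; rewrite addrC subrK.
  have Nsub : Lp_norm p v <= Lp_norm p u + Lp_norm p (u - v).
    have := (Lp_norm_seminorm p1).1 _ _ Lu (Lp_inputsZ p1 (-1) Luv).
    rewrite (Lp_norm_seminorm p1).2// normrN normr1 mul1r scaleN1r opprB.
    by rewrite addrC subrK.
  have qv : q n v <= `|C0| * Lp_norm p v.
    apply: (le_trans (C0P n v _)) => //.
    by rewrite ler_wpM2r ?ler_norm// Lp_norm_ge0.
  have qvu := le_trans qv (ler_wpM2l (normr_ge0 C0) Nsub).
  apply: (le_trans qsub); apply: (le_trans (lerD qvu (qc _ Luv))).
  rewrite mulrDr -addrA lerD2l -mulrDl (addrC `|C0|).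
  apply: (@le_trans _ _ ((c n + `|C0|) * e')).
    by rewrite ler_wpM2l// addr_ge0.
  by rewrite /e' mulrCA ler_piMr ?(ltW e0)// ler_pdivrMr// mul1r lerDl.
have cv : `|resolvent_approx S lambda Q n (Phi 1 u)| @[n --> \oo] --> `|Phi 1
  u|.
  by apply: cvg_norm; exact: resolvent_approx_cvg.
by apply: (cvgr_to_le cv); apply: nearW => n; exact: qC.
Qed.

(** On a short interval the input only matters through its restriction to that
    interval, whose norm is small; around [t] the input map is, up to such a
    small error, an orbit of the semigroup. *)
Lemma input_map_continuous r u : p = r%:E -> Lp_inputs p u ->
  {within nonnegatives, continuous (fun t => Phi t u)}.
Proof.
move=> pr Lu; have r1 : 1 <= r by rewrite -lee_fin -pr.
have [C C0 PhiC] := input_map_bounded pr.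
have PhiC_short h v : 0 <= h <= 1 -> Lp_inputs p v -> `|Phi h v| <= C * Lp_norm
  p v.
  move=> /andP[h0 h1] Lv; have h1' : 0 <= 1 - h by rewrite subr_ge0.
  rewrite -(input_map_delay h1' h0 Lv) addrC subrK.
  apply: (le_trans (PhiC _ (Lp_inputs_delay p1 h1' Lv))).
  by rewrite ler_wpM2l// Lp_norm_delay.
apply/within_nonnegatives_continuousP => t e t0 e0.
pose e' := e / (3 * (C + 1)).
have C1 : 0 < C + 1 by rewrite ltr_wpDl.
have e'0 : 0 < e' by rewrite divr_gt0// mulr_gt0.
have [d0 d00 d0P] : exists2 dlt, 0 < dlt & forall A : set (measurableTypeR R),
    measurable A -> (leb A < dlt%:E)%E -> Lp_norm p (cut_input A u) <= e'.
  by move: Lu; rewrite pr => Lu; exact: Lp_norm_cut_small.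
(* [2 * d] is less than [d0], and at most [1] as [PhiC_short] requires. *)
pose d := Num.min (d0 / 3) 2^-1.
have d_gt0 : 0 < d by rewrite lt_min divr_gt0//= invr_gt0.
have d_half : d <= 2^-1 by rewrite ge_min lexx orbT.
have d_d0 : 2 * d < d0.
  have : d <= d0 / 3 by rewrite ge_min lexx.
  lra.
pose a := Num.max (t - d) 0.
have a0 : 0 <= a by rewrite le_max lexx orbT.
have at_ : a <= t by rewrite ge_max t0 gerBl ltW.
have ta : t <= a + d by rewrite -lerBlDr le_max lexx.
pose v := shift_input a u.
have Lv : Lp_inputs p v by exact: Lp_inputs_shift.
pose A : set (measurableTypeR R) := `[a, a + 2 * d]%classic.
have mA : measurable A by exact: measurable_itv.
have small : Lp_norm p (cut_input A u) <= e'.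
  apply: d0P => //; rewrite lebesgue_measure_itv/=.
  case: ifP => _; last by rewrite lte_fin.
  by rewrite -EFinB lte_fin addrAC subrr add0r.
have LAu := Lp_inputs_cut p1 mA Lu.
have PhiE s : 0 <= s -> Phi (s + a) u = S s (Phi a u) + Phi s v.
  by move=> s0; rewrite input_map_cocycle.
have Phi_small s : 0 <= s <= 2 * d -> `|Phi s v| <= C * e'.
  move=> /andP[s0 s2].
  have -> : Phi s v = Phi s (shift_input a (cut_input A u)).
    apply: Phi_ae_eq => //; first exact: Lp_inputs_shift.
    apply: aeW => x /andP[x0 xs].
    rewrite /v /shift_input /cut_input mem_set// /A /= in_itv/= lerDr x0/=.
    by rewrite addrC lerD2l (le_trans xs).
  apply: le_trans (PhiC_short _ _ _ _) _.
  - by rewrite s0 (le_trans s2)//; lra.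
  - exact: Lp_inputs_shift.
  rewrite ler_wpM2l//; apply: le_trans small.
  exact: Lp_norm_shift.
have cS := (within_nonnegatives_continuousP _).1
  (@semigroup_continuous _ _ _ hS (Phi a u)).
have ta0 : 0 <= t - a by rewrite subr_ge0.
have e3 : 0 < e / 3 by rewrite divr_gt0.
have [d1 d10 d1P] := cS _ _ ta0 e3.
exists (Num.min d1 d); first by rewrite lt_min d10.
move=> s s0; rewrite lt_min => /andP[sd1 sd].
have sa : a <= s.
  rewrite ge_max s0 andbT; move: sd; rewrite ltr_norml => /andP[+ _]; lra.
have sE : s = (s - a) + a by rewrite subrK.
have tE : t = (t - a) + a by rewrite subrK.
have sa0 : 0 <= s - a by rewrite subr_ge0.
have sa2 : s - a <= 2 * d by move: sd; rewrite ltr_norml => /andP[_]; lra.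
have ta2 : t - a <= 2 * d by lra.
rewrite [in X in X - _]sE [in X in _ - X]tE !PhiE//.
have h1 : `|Phi (s - a) v| <= C * e' by apply: Phi_small; rewrite sa0.
have h2 : `|Phi (t - a) v| <= C * e' by apply: Phi_small; rewrite ta0.
have h3 : `|S (s - a) (Phi a u) - S (t - a) (Phi a u)| < e / 3.
  by apply: d1P => //; rewrite opprB addrA subrK.
have h4 : C * e' <= e / 3.
  rewrite /e' invfM [e * _]mulrA mulrCA -[leRHS]mulr1 ler_wpM2l//;
    first by rewrite divr_ge0// ltW.
  by rewrite ler_pdivrMr// mul1r lerDl.
rewrite opprD addrACA; apply: (le_lt_trans (ler_normD _ _)).
have := ltr_leD h3 (le_trans (ler_normB _ _) (lerD h1 h2)).
move=> /lt_le_trans; apply; apply: (le_trans (lerD (lexx _) (lerD h4 h4))).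
by rewrite le_eqVlt; apply/orP; left; apply/eqP; field.
Qed.

End control_systems.

(** * Weak and strong input-to-state stability *)

Theorem proposition4p3 (R : realType) (X U : completeNormedModType R)
  (p : \bar R) (hp : (1 <= p)%E)
  (* A generates the semigroup S on X *)
  (A : set (X * X)) (S : R -> X -> X)
  (hS : C0_semigroup S) (hA : A = generator S)
  (* the extrapolation space and the extension of S to it *)
  (Xm1 : completeNormedModType R) (j : {linear X -> Xm1})
  (hj : is_extrapolation_space A j)
  (Sm1 : R -> Xm1 -> Xm1)
  (hSm1 : C0_semigroup Sm1) (hext : extends_semigroup j S Sm1)
  (B : {linear U -> Xm1}) (hB : continuous B)
  (hadm : admissible j Sm1 B (Lp_inputs p))
  (hcont : p = +oo%E -> forall u : R -> U, Lp_inputs p u ->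
     {within nonnegatives, continuous (fun t => input_map j Sm1 B t u)}) :
  dynamical_system_with_inputs (control_system j Sm1 B S p) /\
  (weakly_ISS (control_system j Sm1 B S p) <->
   strongly_ISS (control_system j Sm1 B S p)).
Proof.
have [_ [lambda [Q [hQ jQ]]]] := hj; rewrite hA in hQ.
have L0 := (Lp_inputs_linear (U := U) hp).1.
have N0 : Lp_norm p (fun=> 0 : U) = 0.
  have [_ _ N_eq0] := Lp_norm_is_norm (U := U) hp; apply/N_eq0 => //.
  by apply/eq_upto_halfline; exact: aeW.
have S0 t : 0 <= t -> S t 0 = 0.
  by move=> t0; have [L <- _] := semigroup_linear_map hS t0; rewrite linear0.
have Phi_cont u : Lp_inputs p u ->
    {within nonnegatives, continuous (fun t => input_map j Sm1 B t u)}.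
  move=> Lu; have [py|pfin] := eqVneq p +oo%E; first exact: hcont.
  have pE : p = (fine p)%:E.
    by rewrite fineK// fin_numE pfin andbT gt_eqF// (lt_le_trans _ hp)// ltNyr.
  exact: (input_map_continuous hp hS hSm1 hext hB hadm hQ jQ pE Lu).
split.
  split => /=.
  - exact: (ae_filter_ringOfSetsType (@lebesgue_nonneg R)).
  - by exists (fun=> 0).
  - by move=> u v Lu /eq_upto_halfline; exact: Lp_inputs_saturated.
  - exists (Lp_inputs p), (Lp_norm p); split => //.
      exact: Lp_inputs_linear.
    exact: Lp_norm_is_norm.
  - by move=> u tau Lu tau0; split; [exact: Lp_inputs_shift|exact:
    Lp_norm_shift].
  - by move=> u1 u2 tau Lu1 Lu2 tau0; exact: Lp_inputs_concat.
  - move=> x0 u Lu.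
    by rewrite (semigroup0 hS) (input_map_time0 hp hSm1 hadm hQ jQ)// addr0.
  - move=> x0 u s t Lu s0 t0.
    rewrite (input_map_cocycle hp hSm1 hext hadm hQ jQ)// (semigroupD hS)//.
    have [L <- _] := semigroup_linear_map hS t0.
    by rewrite linearD addrA.
  - move=> x0 u Lu; apply/subspace_continuousP => t t0.
    have /subspace_continuousP cS := @semigroup_continuous _ _ _ hS x0.
    have /subspace_continuousP cPhi := Phi_cont u Lu.
    by apply: cvgD; [exact: cS|exact: cPhi].
  - move=> x0 u1 u2 tau Lu1 Lu2 tau0 u12 t /andP[t0 ttau].
    congr (_ + _); apply: (input_map_causal hadm hQ jQ t0 Lu1 Lu2).
    have F := ae_filter_ringOfSetsType (@lebesgue_nonneg R).
    apply: filterS u12 => s H; rewrite /= in_itv/= => /andP[s0 st].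
    by apply: H; rewrite /= in_itv/= s0 (le_trans st).
split=> -[ugs ag]; split => //.
  (* Uniform stability from the state [0] bounds the input map by [gamma]; the
     weak gain for the input [0] makes the orbits of [S] decay, at a rate that
     does not involve the inputs.  The flow is the sum of the two. *)
  have [sigma [gamma [sigmaK gammaK bound]]] := ugs.
  have [gamma' gamma'K weak] := ag.
  have gamma'0 : gamma' 0 = 0 by case: gamma'K => [[_ _]|->].
  exists gamma; first by left.
  move=> eps x0 eps0.
  have [tau tau0 decay] := weak eps x0 (fun=> 0) eps0 L0.
  exists tau => // t u taut Lu; have t0 := le_trans tau0 taut.
  apply: (le_trans (ler_normD _ _)); apply: lerD.
    have := decay t taut; rewrite /= (input_map_fun0 hp hSm1 hadm hQ jQ)//
      addr0.
    by rewrite N0 gamma'0 addr0.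
  have := bound 0 u t Lu t0; rewrite /= S0// add0r normr0.
  by have [_ _ ->] := sigmaK; rewrite add0r.
have [gamma gammaK strong] := ag.
exists gamma => // eps x0 u eps0 Lu.
have [tau tau0 decay] := strong eps x0 eps0.
by exists tau => // t taut; exact: decay.
Qed.
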